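(* Let $\mathcal{N}(t)$, $t>0$, be a nonlinear pure birth process with pairwise distinct birth rates $\lambda_k>0$, $k\ge1$, and $\mathcal{N}(0)=1$, and let $\Gamma_t=\int_0^tI_{[0,\infty)}(B(s))\,ds$ be the sojourn time on the positive half-line, during $[0,t]$, of a standard Brownian motion $B$ independent of $\mathcal{N}$. Then $$\Pr\{\mathcal{N}(\Gamma_t)=k\}=\begin{cases}\displaystyle\prod_{j=1}^{k-1}\lambda_j\sum_{m=1}^k\frac{e^{-\frac t2\lambda_m}I_0\!\left(\frac t2\lambda_m\right)}{\prod_{l=1,l\neq m}^k(\lambda_l-\lambda_m)},&k>1,\ t>0,\\[2mm]e^{-\frac t2\lambda_1}I_0\!\left(\frac t2\lambda_1\right),&k=1,\ t>0,\end{cases}$$ where $I_0(z)=\sum_{k=0}^\infty\left(\frac z2\right)^{2k}\frac1{(k!)^2}$ is the zero-order Bessel function with imaginary argument.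
   Context: The nonlinear pure birth process $\mathcal{N}(t)$ with rates $(\lambda_k)_{k\ge1}$ is the continuous-time Markov chain on $\{1,2,\dots\}$ started at $1$ which from state $k$ jumps only to $k+1$, at rate $\lambda_k$; it is assumed throughout that $\sum_k1/\lambda_k=\infty$ (no explosion). *)

(* Defs.v *)
From HB Require Import structures.
From mathcomp Require Import all_boot all_order all_algebra.
From mathcomp Require Import all_classical all_reals all_analysis.

Set Implicit Arguments.
Unset Strict Implicit.
Unset Printing Implicit Defensive.

Import Order.TTheory GRing.Theory Num.Theory.
Import numFieldNormedType.Exports.

Local Open Scope classical_set_scope.
Local Open Scope ring_scope.

(* Processes are families indexed by all of R; only the times t >= 0 are
   constrained or used. *)

Definition cond_prob d (T : measurableType d) (R : realType)
    (P : probability T R) (A C : set T) : R :=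
  fine (P (A `&` C)) / fine (P C).

Definition mutually_independent d (T : measurableType d) (R : realType)
    (P : probability T R) (n : nat) (X : 'I_n -> T -> R) : Prop :=
  forall A : 'I_n -> set R, (forall i, measurable (A i)) ->
    P (\bigcap_i (X i @^-1` A i)) = (\prod_i P (X i @^-1` A i))%E.

(* The sigma-algebra generated by (X t) for t >= 0. *)
Definition sigma_process d d' (T : measurableType d) (S : measurableType d')
    (R : realType) (P : probability T R) (X : R -> {RV P >-> S}) :
    set (set T) :=
  <<s [set E | exists t A, [/\ 0 <= t, measurable A & E = X t @^-1` A]] >>.

Definition independent_processes d d1 d2 (T : measurableType d)
    (S1 : measurableType d1) (S2 : measurableType d2) (R : realType)
    (P : probability T R) (X : R -> {RV P >-> S1}) (Y : R -> {RV P >-> S2}) :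
    Prop :=
  forall E F, sigma_process X E -> sigma_process Y F ->
    P (E `&` F) = (P E * P F)%E.

(* normal_prob takes the standard deviation.  For deviation 0 it is not a
   Dirac mass, hence the strict s < t. *)
Record brownian_motion d (T : measurableType d) (R : realType)
    (P : probability T R) (B : R -> {RV P >-> R}) : Prop := BrownianMotion {
  bm_start : {ae P, forall w, B 0 w = 0} ;
  bm_indep : forall (n : nat) (u : nat -> R),
    0 <= u 0%N -> (forall j, (j < n)%N -> u j < u j.+1) ->
    mutually_independent P (fun j : 'I_n => B (u j.+1) \- B (u j)) ;
  bm_gauss : forall s t : R, 0 <= s -> s < t ->
    forall A : set R, measurable A ->
    pushforward P (B t \- B s) A = normal_prob 0 (Num.sqrt (t - s)) A ;
  bm_cont : forall w, {within `[0, +oo[, continuous (fun t : R => B t w)} }.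

(* p h i j is the probability of moving from i to j in a time lapse h. *)
Definition markov_chain d (T : measurableType d) (R : realType)
    (P : probability T R) (p : R -> nat -> nat -> R)
    (X : R -> {RV P >-> nat}) : Prop :=
  forall (n : nat) (u : nat -> R) (i : nat -> nat),
    0 <= u 0%N -> (forall j, (j <= n)%N -> u j < u j.+1) ->
    let past := [set w | forall j, (j <= n)%N -> X (u j) w = i j] in
    P past != 0%E ->
    cond_prob P [set w | X (u n.+1) w = i n.+1] past
      = p (u n.+1 - u n) (i n) (i n.+1).

(* The rates say that, as h -> 0+, p h k k.+1 = lam k * h + o(h) and
   p h k k = 1 - lam k * h + o(h), so that every other transition out of k has
   probability o(h).  lam 0 is never used. *)
Record pure_birth_process d (T : measurableType d) (R : realType)
    (P : probability T R) (lam : nat -> R) (N : R -> {RV P >-> nat}) : Prop :=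
  PureBirthProcess {
  pb_start : {ae P, forall w, N 0 w = 1%N} ;
  pb_states : forall t w, 0 <= t -> (1 <= N t w)%N ;
  pb_rcont : forall t w, 0 <= t -> \forall s \near t^'+, N s w = N t w ;
  pb_jumps : {ae P, forall w, forall t, 0 < t -> exists k : nat,
    (\forall s \near t^'-, N s w = k) /\ (N t w = k \/ N t w = k.+1)} ;
  pb_markov : exists2 p : R -> nat -> nat -> R, markov_chain p N &
    forall k, (1 <= k)%N ->
      (p h k k.+1 / h @[h --> 0^'+] --> lam k) /\
      ((1 - p h k k) / h @[h --> 0^'+] --> lam k) }.

Definition sojourn_time d (T : measurableType d) (R : realType)
    (P : probability T R) (B : R -> {RV P >-> R}) (t : R) (w : T) : R :=
  \int[lebesgue_measure]_(s in `[0, t]) \1_(`[0, +oo[) (B s w).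

Definition bessel_I0 (R : realType) (z : R) : R :=
  limn (series (fun k => (z / 2) ^+ (2 * k) * (k`!%:R ^+ 2)^-1)).

(* Main.v *)
Require Import Defs.
From HB Require Import structures.
From mathcomp Require Import all_boot all_order all_algebra.
From mathcomp Require Import all_classical all_reals all_analysis.
From mathcomp Require Import measurable_realfun.
From mathcomp Require Import ring lra zify.

Set Implicit Arguments.
Unset Strict Implicit.
Unset Printing Implicit Defensive.
Import Order.TTheory GRing.Theory Num.Theory.
Import numFieldNormedType.Exports.
Local Open Scope classical_set_scope.
Local Open Scope ring_scope.

(** By independence and right continuity, P(N(G_t) = k) = E[q_k(G_t)], where G_t is the
    sojourn time and q_k(s) = P(N(s) = k) is a combination of the exponentials
    exp(-lam_m s), 1 <= m <= k; so everything reduces to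
    E[exp(-l G_t)] = exp(-l t/2) I_0(l t/2), i.e. to the arcsine law of G_t / t.

    That law is identified by its moments u_r = C(2r,r) / 4^r.  Let K_n be the number of
    indices 1 <= j <= n with B(j t/n) > B(0), so that K_n / n -> G_t / t almost surely.
    Then C(K_n, r) counts the lists d of r positive gaps of total at most n along which
    B stays above B(0).  Let h(d) be the probability of that event.  Cutting the path
    at its almost surely unique maximum along d gives
      sum_k h(rev (take k d)) h(drop k d) = 1,
    because the increments are independent and symmetric, with a law given by the gap.
    Summed over all d with multiplicative weights, this self-convolution identity has
    u_r times the total weight as its unique solution, since sum_k u_k u_(r-k) = 1.
    Hence E[C(K_n, r)] = u_r C(n, r), and E[(G_t/t)^r] = u_r in the limit.

    For the law of N, paths are nondecreasing, so q_k(s+h) only involves the states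
    i <= k at time s, and the rates give the forward equations up to an error o(h) that is
    uniform in s; an Euler scheme then identifies q_k with the explicit solution. *)

(** * Central binomial sums and sums over words *)

Lemma central_binS k : (k.+1 * 'C(k.+1.*2, k.+1) = 2 * (k.*2.+1) * 'C(k.*2, k))%N.
Proof.
have H1 := mul_bin_diag (k.*2.+2) k.
have H2 := mul_bin_down (k.*2.+1) k.
have E : (k.*2.+1 - k = k.+1)%N by lia.
rewrite E /= in H2; rewrite /= in H1.
have -> : k.+1.*2 = k.*2.+2 by lia.
rewrite -H1 /= -mulnA H2; lia.
Qed.

(* By symmetry [\sum_k k c_k c_(n-k) = n a_n / 2]; with [central_binS] this gives
   [a_(n+1) = 4 a_n] for the convolution [a]. *)
Lemma sum_central_bin n :
  (\sum_(k < n.+1) 'C(k.*2, k) * 'C((n - k).*2, n - k) = 4 ^ n)%N.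
Proof.
pose c k := 'C(k.*2, k).
pose a n := (\sum_(k < n.+1) c k * c (n - k)%N)%N.
have half m : (2 * (\sum_(k < m.+1) k * (c k * c (m - k))) = m * a m)%N.
  have -> : (2 * (\sum_(k < m.+1) k * (c k * c (m - k))) =
    \sum_(k < m.+1) k * (c k * c (m - k)) + \sum_(k < m.+1) (m - k) * (c k * c (m - k)))%N.
    rewrite mul2n -addnn; congr addn.
    rewrite (reindex_inj rev_ord_inj); apply: eq_bigr => i _ /=.
    rewrite subSS subKn; last by rewrite -ltnS.
    by rewrite [(c (m - i) * _)%N]mulnC.
  rewrite -big_split /= /a big_distrr /=; apply: eq_bigr => i _.
  by rewrite -mulnDl subnKC // -ltnS.
rewrite -/(a n); elim: n => [|n IH]; first by rewrite /a big_ord1.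
have key : (n.+1 * a n.+1 = n.+1 * (4 * a n))%N.
  rewrite -half big_ord_recl mul0n add0n.
  under eq_bigr do rewrite /= subSS mulnA central_binS -mulnA.
  have -> : (2 * (\sum_(i < n.+1) (2 * i.*2.+1 * ('C(i.*2, i) * c (n - i))))
     = 4 * (2 * \sum_(i < n.+1) i * (c i * c (n - i)) + a n))%N.
    rewrite /a !big_distrr /= -big_split /= big_distrr /=; apply: eq_bigr => i _.
    rewrite -/(c i); nia.
  by rewrite half; lia.
have : a n.+1 = (4 * a n)%N by apply/eqP; rewrite -(eqn_pmul2l (ltn0Sn n)) key.
by move=> ->; rewrite IH expnS.
Qed.

Lemma coef_expr1DX (R : nzRingType) n k :
  ((1 + 'X) ^+ n : {poly R})`_k = ('C(n, k))%:R.
Proof.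
rewrite exprDn_comm; last exact/commr_sym/commr1.
rewrite coef_sum.
under eq_bigr do rewrite expr1n mul1r coefMn coefXn.
have [kn|kn] := ltnP k n.+1; last first.
  rewrite bin_small // big1 // => i _; case: eqP => [e|_]; last by rewrite mul0rn.
  by have := ltn_ord i; lia.
rewrite (bigD1 (Ordinal kn)) //= eqxx big1 ?addr0 // => i ik.
by case: eqP => [e|_]; [rewrite -val_eqE /= e eqxx in ik|rewrite mul0rn].
Qed.

(* Coefficient of 'X^m in [((1 + 'X)^2 - 2 'X)^m = (1 + 'X^2)^m]. *)
Lemma sum_bin_central (R : comNzRingType) m :
  \sum_(i < m.+1) (-2) ^+ (m - i) * ('C(m, i) * 'C(i.*2, i))%:R
  = (if odd m then 0 else ('C(m, m./2))%:R) :> R.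
Proof.
have E : ((1 + 'X) ^+ 2 - 2 * 'X) ^+ m = (1 + 'X^2) ^+ m :> {poly R}.
  by congr (_ ^+ m); rewrite expr2; ring.
have := congr1 (fun p : {poly R} => p`_m) E.
rewrite addrC exprDn coef_sum.
under eq_bigr => i _.
  rewrite coefMn -mulNr exprMn -exprM mulrAC.
  have -> : (-2 : {poly R}) ^+ (m - i) = ((-2) ^+ (m - i))%:P.
    by rewrite rmorphXn rmorphN rmorph_nat.
  rewrite coefMXn ltnNge leq_subr /= subKn; last by rewrite -ltnS.
  rewrite coefCM coef_expr1DX mul2n -(mulr_natr (_ * _)) -mulrA -natrM mulnC.
  over.
move=> ->.
have -> : (1 + 'X^2 : {poly R}) ^+ m = \sum_(i < m.+1) 'X^(i.*2) *+ 'C(m, i).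
  rewrite exprDn; apply: eq_bigr => i _; by rewrite expr1n mul1r -exprM mul2n.
rewrite coef_sum.
under eq_bigr do rewrite coefMn coefXn.
have [om|om] := boolP (odd m).
  rewrite big1 // => i _; case: eqP => [e|_]; last by rewrite mul0rn.
  by rewrite e odd_double in om.
have hm : (m./2 < m.+1)%N by lia.
rewrite (bigD1 (Ordinal hm)) //= big1 ?addr0.
  by rewrite halfK (negbTE om) subn0 eqxx.
move=> i im; case: eqP => [e|_]; last by rewrite mul0rn.
by move: im e; rewrite -val_eqE /=; lia.
Qed.

Section WordSums.
Variables (R : comNzRingType) (D : finType).

(** Recursion on the first letter makes cutting and reversing words plain inductions. *)
Fixpoint wsum (r : nat) (F : seq D -> R) : R :=
  if r is r'.+1 then \sum_x wsum r' (fun s => F (x :: s)) else F [::].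

Lemma eq_wsum r (F G : seq D -> R) :
  (forall s, size s = r -> F s = G s) -> wsum r F = wsum r G.
Proof.
elim: r F G => [|r IH] F G FG /=; first exact: FG.
by apply: eq_bigr => x _; apply: IH => s sr; apply: FG; rewrite /= sr.
Qed.

Lemma wsum_linear (a b : R) r (F G : seq D -> R) :
  wsum r (fun s => a * F s + b * G s) = a * wsum r F + b * wsum r G.
Proof.
elim: r F G => [//|r IH] F G /=.
under eq_bigr do rewrite IH.
by rewrite big_split /= -!big_distrr.
Qed.

Lemma wsum_sum r n (F : 'I_n -> seq D -> R) :
  wsum r (fun s => \sum_(i < n) F i s) = \sum_(i < n) wsum r (F i).
Proof.
elim: r F => [//|r IH] F /=.
by rewrite exchange_big /=; apply: eq_bigr => x _; rewrite IH.
Qed.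

Lemma wsum_cat k l (F : seq D -> R) :
  wsum (k + l) F = wsum k (fun s => wsum l (fun s' => F (s ++ s'))).
Proof.
elim: k F => [//|k IH] F /=; by apply: eq_bigr => x _; rewrite IH.
Qed.

Lemma wsum_rcons r (F : seq D -> R) :
  wsum r.+1 F = \sum_x wsum r (fun s => F (rcons s x)).
Proof.
elim: r F => [//|r IH] F.
rewrite [RHS]exchange_big /=; apply: eq_bigr => x _.
exact: (IH (fun s => F (x :: s))).
Qed.

Lemma wsum_rev r (F : seq D -> R) : wsum r (fun s => F (rev s)) = wsum r F.
Proof.
elim: r F => [//|r IH] F; rewrite [RHS]wsum_rcons /=; apply: eq_bigr => x _.
rewrite -(IH (fun s => F (rcons s x))); apply: eq_wsum => s _.
by rewrite rev_cons.
Qed.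

Lemma wsum_prod r (c : D -> R) :
  wsum r (fun s => \prod_(x <- s) c x) = (\sum_x c x) ^+ r.
Proof.
elim: r => [|r IH] /=; first by rewrite big_nil.
rewrite exprS big_distrl; apply: eq_bigr => x _ /=.
rewrite -IH.
transitivity (wsum r (fun s => c x * \prod_(y <- s) c y + 0 * 0)).
  by apply: eq_wsum => s _; rewrite big_cons mul0r addr0.
by rewrite wsum_linear mul0r addr0.
Qed.

End WordSums.

Lemma wsum_raddf (R S : comNzRingType) (D : finType) (f : {additive R -> S})
    r (F : seq D -> R) : f (wsum r F) = wsum r (f \o F).
Proof.
elim: r F => [//|r IH] F /=.
by rewrite raddf_sum; apply: eq_bigr => x _; rewrite IH.
Qed.

(** Since the sequences start at 1, the identity of index [r.+1] is [2 * a r.+1] plus products of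
    earlier values, which agree by strong induction. *)
Lemma self_convolution_inj (R : comNzRingType) (a b : nat -> R) :
  GRing.lreg (2 : R) -> a 0%N = 1 -> b 0%N = 1 ->
  (forall r, \sum_(k < r.+1) a k * a (r - k)%N = \sum_(k < r.+1) b k * b (r - k)%N) ->
  forall r, a r = b r.
Proof.
move=> reg2 a0 b0 ab r.
have [n] := ubnP r; elim: n r => // n IH [_|r rn]; first by rewrite a0 b0.
have ends (f : nat -> R) :
    \sum_(k < r.+2) f k = f 0%N + f r.+1 + \sum_(k < r) f k.+1.
  by rewrite big_ord_recl big_ord_recr /= addrA addrAC.
apply: reg2; have := ab r.+1.
rewrite (ends (fun k => a k * a (r.+1 - k)%N)) (ends (fun k => b k * b (r.+1 - k)%N)).
rewrite !subn0 !subnn a0 b0 !mul1r !mulr1.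
have -> : \sum_(k < r) a k.+1 * a (r.+1 - k.+1)%N =
    \sum_(k < r) b k.+1 * b (r.+1 - k.+1)%N.
  by apply: eq_bigr => i _; have ir := ltn_ord i; rewrite !IH //; lia.
by move/addIr; rewrite !mulr_natl !mulr2n.
Qed.

(** Product weights are multiplicative when a word is cut and blind to reversal. Summed over all
    words of length [r], the cut identity thus says that the weighted sums of [h] convolve with
    themselves to the powers of [\sum_x c x]; the sequence [u r * (\sum_x c x) ^+ r] does so too. *)
Lemma wsum_ladder (R : comNzRingType) (D : finType) (c : D -> R)
    (h : seq D -> R) (u : nat -> R) :
  GRing.lreg (2 : R) -> u 0%N = 1 ->
  (forall r, \sum_(k < r.+1) u k * u (r - k)%N = 1) ->
  h [::] = 1 ->
  (forall s, \sum_(k < (size s).+1) h (rev (take k s)) * h (drop k s) = 1) ->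
  forall r, wsum r (fun s => h s * \prod_(x <- s) c x) = u r * (\sum_x c x) ^+ r.
Proof.
move=> reg2 u0 uu h0 hh.
apply: (self_convolution_inj reg2).
- by rewrite /= h0 big_nil mulr1.
- by rewrite u0 expr0 mulr1.
move=> r.
transitivity ((\sum_x c x) ^+ r); last first.
  rewrite -[LHS]mul1r -[X in X * _](uu r) big_distrl /=; apply: eq_bigr => i _.
  by rewrite mulrACA -exprD subnKC // -ltnS.
rewrite -wsum_prod.
transitivity (wsum r (fun s => \sum_(k < r.+1)
    (h (rev (take k s)) * \prod_(x <- rev (take k s)) c x)
    * (h (drop k s) * \prod_(x <- drop k s) c x))); last first.
  apply: eq_wsum => s sr; rewrite -[RHS]mul1r -[X in _ = X * _](hh s) sr big_distrl /=.
  apply: eq_bigr => k _.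
  rewrite mulrACA; congr (_ * _).
  by rewrite -{3}(cat_take_drop k s) big_cat /= big_rev.
rewrite wsum_sum; apply: eq_bigr => k _.
have kr (F : seq D -> R) : wsum r F = wsum (k + (r - k)) F by rewrite subnKC // -ltnS.
rewrite [RHS]kr wsum_cat.
(* The prefix is summed in reversed form, to match the [rev] on the other side. *)
rewrite -(wsum_rev k).
have wsumZr (x : R) l (F : seq D -> R) : wsum l (fun s => x * F s) = x * wsum l F.
  rewrite -[RHS]addr0 -[X in _ + X](mul0r (wsum l F)) -wsum_linear.
  by apply: eq_wsum => s _; rewrite mul0r addr0.
rewrite mulrC -wsumZr; apply: eq_wsum => s sk.
rewrite mulrC -wsumZr; apply: eq_wsum => s' _.
by rewrite -sk take_size_cat // drop_size_cat.
Qed.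

Section Gaps.
Variable n : nat.

(* Letter [x : 'I_n] stands for a gap of length [x.+1]. *)
Definition gap_total (s : seq 'I_n) : nat := \sum_(x <- s) x.+1.

Fixpoint all_hits (b : nat -> bool) (m : nat) (s : seq 'I_n) : bool :=
  if s is x :: s' then b (m + x.+1)%N && all_hits b (m + x.+1) s' else true.

(** An [r.+1]-subset of the hits after [m] is its smallest element [j] together with an [r]-subset
    of the hits after [j]. The induction on [n - m] is Pascal's rule. *)
Lemma sum_hits_bin (b : nat -> bool) r m : (m <= n)%N ->
  (\sum_(m.+1 <= j < n.+1) b j * 'C(\sum_(j.+1 <= i < n.+1) b i, r)
   = 'C(\sum_(m.+1 <= j < n.+1) b j, r.+1))%N.
Proof.
move=> mn; rewrite -(subKn mn).
elim: (n - m)%N (leq_subr m n) => [|l IH] ln.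
  by rewrite subn0 !big_geq.
have E : (n - l = (n - l.+1).+1)%N by lia.
have lt : ((n - l.+1).+1 < n.+1)%N by lia.
rewrite (big_ltn lt) [in RHS](big_ltn lt) -E IH; last by lia.
by case: (b _); rewrite ?mul1n ?mul0n // add1n binS addnC.
Qed.

(** Partial sums turn a word of gaps into an increasing list of positions after [m], so the words
    counted are the [r]-subsets of the hits up to [n]; the first gap selects the smallest
    element. *)
Lemma wsum_hits (R : comNzRingType) (b : nat -> bool) r m : (m <= n)%N ->
  wsum r (fun s => (all_hits b m s && (m + gap_total s <= n)%N)%:R) =
  ('C(\sum_(m.+1 <= j < n.+1) b j, r))%:R :> R.
Proof.
elim: r m => [|r IH] m mn /=.
  by rewrite /gap_total big_nil addn0 mn bin0.
rewrite -sum_hits_bin // natr_sum.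
transitivity (\sum_(x < n | (m + x.+1 < n.+1)%N)
   (b (m + x.+1) * 'C(\sum_((m + x.+1).+1 <= i < n.+1) b i, r))%:R : R).
  rewrite [RHS]big_mkcond; apply: eq_bigr => x _.
  case: ifPn => mx.
    transitivity (wsum r (fun s : seq 'I_n => (b (m + x.+1))%:R *
        (all_hits b (m + x.+1) s && (m + x.+1 + gap_total s <= n)%N)%:R + 0 * 0 : R)).
      apply: eq_wsum => s _; rewrite mul0r addr0 /gap_total big_cons addnA.
      by rewrite -natrM mulnb andbA.
    by rewrite wsum_linear mul0r addr0 IH // natrM.
  transitivity (wsum r (fun s : seq 'I_n => 0 * 0 + 0 * 0 : R)).
    apply: eq_wsum => s _; rewrite mul0r addr0 /gap_total big_cons addnA.
    by case: leqP => //; rewrite ?andbF //; lia.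
  by rewrite wsum_linear !mul0r addr0.
have -> : \sum_(m.+1 <= j < n.+1) (b j * 'C(\sum_(j.+1 <= i < n.+1) b i, r))%:R =
    \sum_(0 + m.+1 <= j < n.+1) (b j * 'C(\sum_(j.+1 <= i < n.+1) b i, r))%:R :> R.
  by rewrite add0n.
rewrite big_addn big_mkord.
rewrite (big_ord_widen n (fun i => (b (i + m.+1)%N *
   'C(\sum_((i + m.+1).+1 <= j < n.+1) b j, r))%:R : R)); last by lia.
apply: eq_big => [x|x _]; first by lia.
by have -> : (x + m.+1 = m + x.+1)%N by lia.
Qed.

Lemma wsum_gap_total (R : comNzRingType) r :
  wsum r (fun s => (gap_total s <= n)%N%:R) = ('C(n, r))%:R :> R.
Proof.
transitivity (('C(\sum_(1 <= j < n.+1) true, r))%:R : R); last first.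
  by rewrite sum_nat_const_nat muln1 subn1.
rewrite -(wsum_hits _ (fun=> true)) //; apply: eq_wsum => s _.
rewrite add0n.
suff hT m : all_hits (fun=> true) m s by rewrite hT.
by elim: s m => //= x s IH m; exact: IH.
Qed.

(** The restriction on the total gap is not multiplicative over letters. Polynomial weights are, and
    adding their coefficients of degree at most [n] restores it. *)
Lemma wsum_ladder_gaps (R : fieldType) (h : seq 'I_n -> R) (u : nat -> R) :
  (2 : R) != 0 -> u 0%N = 1 ->
  (forall r, \sum_(k < r.+1) u k * u (r - k)%N = 1) ->
  h [::] = 1 ->
  (forall s, \sum_(k < (size s).+1) h (rev (take k s)) * h (drop k s) = 1) ->
  forall r, wsum r (fun s => h s * (gap_total s <= n)%N%:R) = u r * ('C(n, r))%:R.
Proof.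
move=> two u0 uu h0 hh r.
(* Weighting a gap of length g by 'X^g records the total in the exponent. *)
have H : wsum r (fun s => (h s)%:P * \prod_(x <- s) 'X^(x.+1)) =
    (u r)%:P * (\sum_(x < n) 'X^(x.+1)) ^+ r :> {poly R}.
  apply: (@wsum_ladder _ _ (fun x : 'I_n => 'X^(x.+1)) (fun s => (h s)%:P)
    (fun r => (u r)%:P)).
  - move=> p q; rewrite -(rmorph_nat (@polyC R)) !mul_polyC => /(congr1 ( *:%R (2^-1))).
    by rewrite !scalerA mulVf // !scale1r.
  - by rewrite u0.
  - move=> l; under eq_bigr do rewrite -polyCM.
    by rewrite -rmorph_sum uu.
  - by rewrite h0.
  - move=> s; under eq_bigr do rewrite -polyCM.
    by rewrite -rmorph_sum hh.
have prodX (s : seq 'I_n) : \prod_(x <- s) 'X^(x.+1) = 'X^(gap_total s) :> {poly R}.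
  by rewrite /gap_total; elim: s => [|x s IH]; rewrite ?big_nil // !big_cons IH exprD.
have low m : \sum_(i < n.+1) (i == m :> nat)%:R = (m <= n)%N%:R :> R.
  case: leqP => mn; last first.
    by apply: big1 => i _; have := ltn_ord i; case: eqP => //; lia.
  rewrite (bigD1 (inord m)) //= inordK // eqxx big1 ?addr0 // => i.
  by rewrite -val_eqE /= inordK // => /negbTE ->.
transitivity (\sum_(i < n.+1) (wsum r (fun s => (h s)%:P * \prod_(x <- s) 'X^(x.+1)))`_i).
  under eq_bigr => i _ do rewrite -/(coefp i _) wsum_raddf.
  rewrite -wsum_sum; apply: eq_wsum => s _ /=.
  under eq_bigr do rewrite prodX coefCM coefXn.
  by rewrite -big_distrr low.
rewrite H; under eq_bigr do rewrite coefCM.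
rewrite -big_distrr /=; congr (_ * _).
(* The same extraction with [h] replaced by 1 evaluates the power of the generating polynomial. *)
rewrite -wsum_prod -wsum_gap_total.
under eq_bigr => i _ do rewrite -/(coefp i _) wsum_raddf.
rewrite -wsum_sum; apply: eq_wsum => s _ /=.
under eq_bigr do rewrite prodX coefXn.
exact: low.
Qed.
End Gaps.

Definition arcsine_moment (R : fieldType) r : R := ('C(r.*2, r))%:R / 4 ^+ r.

Lemma sum_arcsine_moment (R : numFieldType) r :
  \sum_(k < r.+1) arcsine_moment R k * arcsine_moment R (r - k) = 1.
Proof.
have -> : \sum_(k < r.+1) arcsine_moment R k * arcsine_moment R (r - k) =
    (\sum_(k < r.+1) 'C(k.*2, k) * 'C((r - k).*2, r - k))%N%:R / 4 ^+ r.
  rewrite natr_sum big_distrl /=; apply: eq_bigr => k _.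
  by rewrite mulrACA -invfM -exprD subnKC ?natrM // -ltnS.
by rewrite sum_central_bin natrX divff // expf_neq0 // pnatr_eq0.
Qed.

(** Centring at the midpoint kills the odd moments and leaves central binomials at even orders, the
    shape of the series of [bessel_I0]. *)
Lemma centered_arcsine_moment (R : numFieldType) m :
  \sum_(i < m.+1) (- 2^-1) ^+ (m - i) * arcsine_moment R i *+ 'C(m, i)
  = (if odd m then 0 else ('C(m, m./2))%:R) / 4 ^+ m.
Proof.
rewrite -sum_bin_central big_distrl /=; apply: eq_bigr => i _.
have im : (i <= m)%N by rewrite -ltnS.
have -> : (4 : R) ^+ m = 4 ^+ (m - i) * 4 ^+ i by rewrite -exprD subnK.
have -> : (- 2^-1 : R) = -2 / 4 by field.
rewrite expr_div_n -mulr_natr /arcsine_moment natrM invfM.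
move: ((-2) ^+ _) ((4 ^+ (m - i))^-1) ((4 ^+ i)^-1) ('C(m, i)%:R) ('C(i.*2, i)%:R).
by move=> a b c x y; ring.
Qed.

(** * Independence and laws of finite families *)

Section PiSystemIndependence.
Context d (T : measurableType d) (R : realType) (P : probability T R).
Implicit Types G H : set (set T).

(** For fixed [B], the restriction of [P] to [B] and [P] scaled by [P B] are finite measures that
    agree on the pi-system [G], hence on what it generates. *)
Let indep_left G B : G `<=` measurable -> setI_closed G -> G setT ->
  measurable B -> (forall A, G A -> P (A `&` B) = (P A * P B)%E) ->
  forall A, <<s G >> A -> P (A `&` B) = (P A * P B)%E.
Proof.
move=> Gm GI GT mB GB A sA.
have PB0 : 0 <= fine (P B) by rewrite fine_ge0.
have EPB : P B = (fine (P B))%:E by rewrite fineK // fin_num_measure.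
have cov : \bigcup_(_ in [set: nat]) [set: T] = setT.
  by apply/seteqP; split=> // w _; exists 0%N.
have key := @g_sigma_algebra_measure_unique _ _ _ G Gm (fun=> setT) (fun=> GT)
  cov (mrestr P mB) (mscale (NngNum PB0) P) GI.
rewrite [RHS]muleC [X in (X * _)%E]EPB.
apply: key => //.
- by move=> C GC; rewrite /= /mrestr /mscale /= -EPB muleC; exact: GB.
- by move=> k; rewrite /= /mrestr setTI ltey_eq fin_num_measure.
Qed.

Lemma pi_system_independence G H : G `<=` measurable -> H `<=` measurable ->
  setI_closed G -> setI_closed H -> G setT -> H setT ->
  (forall A B, G A -> H B -> P (A `&` B) = (P A * P B)%E) ->
  forall A B, <<s G >> A -> <<s H >> B -> P (A `&` B) = (P A * P B)%E.
Proof.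
move=> Gm Hm GI HI GT HT GH A B sA sB.
have mA : measurable A by apply: smallest_sub sA => //; exact: sigma_algebra_measurable.
rewrite setIC muleC; apply: indep_left sB => // C HC.
rewrite setIC muleC; apply: indep_left sA => //; first exact: Hm.
by move=> D GD; exact: GH.
Qed.

End PiSystemIndependence.

Section TupleBoxes.
Context (R : realType) (n : nat).

Definition tuple_boxes : set (set (n.-tuple R)) :=
  [set D | exists2 A : 'I_n -> set R, (forall i, measurable (A i)) &
    D = [set y | forall i, A i (tnth y i)]].

Lemma tuple_boxes_measurable : tuple_boxes `<=` measurable.
Proof.
move=> _ [A mA ->].
rewrite (_ : [set y | _] = \bigcap_i ((fun y : n.-tuple R => tnth y i) @^-1` A i)).
  apply: fin_bigcap_measurable => // i _.
  by rewrite -[X in measurable X]setTI; exact: measurable_tnth.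
by apply/seteqP; split=> y /= h i => [_|]; exact: h.
Qed.

Lemma tuple_boxesI : setI_closed tuple_boxes.
Proof.
move=> _ _ [A mA ->] [B mB ->]; exists (fun i => A i `&` B i).
  by move=> i; exact: measurableI.
by apply/seteqP; split=> y /= => [[hA hB] i|h]; split=> // i; case: (h i).
Qed.

Lemma tuple_boxesT : tuple_boxes setT.
Proof. by exists (fun=> setT) => //; apply/seteqP; split. Qed.

(** A generator of the product sigma-algebra constrains one coordinate, so it is a box whose other
    sides are full. *)
Lemma measurable_tuple_boxes : measurable `<=` <<s tuple_boxes >>.
Proof.
apply: smallest_sub; first exact: smallest_sigma_algebra.
rewrite -bigcup_seq /=; apply: bigcup_sub => i _ _ [A mA <-].
apply: sub_sigma_algebra; exists (fun j => if j == i then A else setT).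
  by move=> j; case: ifP.
rewrite setTI; apply/seteqP; split=> y /= => [Ay j|/(_ i)]; last by rewrite eqxx.
by case: eqP => [->|].
Qed.

End TupleBoxes.

Definition tuple_rv {T : Type} {R : realType} {n : nat} (X : 'I_n -> T -> R) (w : T) :
  n.-tuple R := [tuple X i w | i < n].

Lemma measurable_tuple_rv d (T : measurableType d) (R : realType) n
    (X : 'I_n -> T -> R) :
  (forall i, measurable_fun setT (X i)) -> measurable_fun setT (tuple_rv X).
Proof.
move=> mX; apply/measurable_fun_tnthP => i.
by rewrite (_ : _ \o _ = X i) //; apply/funext => w; rewrite /= tnth_mktuple.
Qed.

Lemma tuple_rv_box T (R : realType) n (X : 'I_n -> T -> R) (A : 'I_n -> set R) :
  tuple_rv X @^-1` [set y | forall i, A i (tnth y i)] = \bigcap_i (X i @^-1` A i).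
Proof.
apply/seteqP; split=> w /= h i.
  by move=> _; have := h i; rewrite tnth_mktuple.
by rewrite tnth_mktuple; exact: h.
Qed.

(** On boxes, which form a generating pi-system, independence reduces both laws to products of equal
    marginals. *)
Lemma mutually_independent_law d d' (T : measurableType d) (T' : measurableType d')
    (R : realType) (P : probability T R) (P' : probability T' R) n
    (X : 'I_n -> T -> R) (X' : 'I_n -> T' -> R) :
  (forall i, measurable_fun setT (X i)) -> (forall i, measurable_fun setT (X' i)) ->
  mutually_independent P X -> mutually_independent P' X' ->
  (forall i A, measurable A -> P (X i @^-1` A) = P' (X' i @^-1` A)) ->
  forall D, measurable D -> P (tuple_rv X @^-1` D) = P' (tuple_rv X' @^-1` D).
Proof.
move=> mX mX' iX iX' law D /measurable_tuple_boxes sD.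
have mtX := measurable_tuple_rv mX; have mtX' := measurable_tuple_rv mX'.
pose M := measure_function_pushforward__canonical__measure_function_Measure.
have cov : \bigcup_(_ in [set: nat]) [set: n.-tuple R] = setT.
  by apply/seteqP; split=> // w _; exists 0%N.
apply: (@g_sigma_algebra_measure_unique _ _ _ _ (@tuple_boxes_measurable R n)
  (fun=> setT) (fun=> tuple_boxesT R n) cov (M _ _ _ _ _ P _ mtX) (M _ _ _ _ _ P' _ mtX')
  (@tuple_boxesI R n)) => //.
- move=> _ [A mA ->]; rewrite /= /pushforward !tuple_rv_box iX // iX' //.
  by apply: eq_bigr => i _; exact: law.
- by move=> k; rewrite /= /pushforward preimage_setT ltey_eq fin_num_measure.
Qed.

Lemma sigma_preimage T T' (f : T -> T') (G : set (set T')) (D : set T') :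
  <<s G >> D -> <<s [set f @^-1` C | C in G] >> (f @^-1` D).
Proof.
move=> sD; pose S := [set E | <<s [set f @^-1` C | C in G] >> (f @^-1` E)].
suff : S D by [].
apply: (smallest_sub _ _ sD) => [|C GC]; last first.
  by apply: sub_sigma_algebra; exists C.
split; rewrite /S /=.
- by rewrite preimage_set0; exact: sigma_algebra0.
- by move=> A sA; rewrite setTD preimage_setC -setTD; exact: sigma_algebraCD.
- by move=> F sF; rewrite preimage_bigcup; exact: sigma_algebra_bigcup.
Qed.

(** By the pi-system criterion boxes suffice, and a box on the first [k] coordinates intersected
    with one on the last [l] is a box on all [k + l]. *)
Lemma mutually_independent_blocks d (T : measurableType d) (R : realType)
    (P : probability T R) k l (X : nat -> T -> R) :
  (forall i, measurable_fun setT (X i)) ->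
  mutually_independent P (fun i : 'I_(k + l) => X i) ->
  mutually_independent P (fun i : 'I_k => X i) ->
  mutually_independent P (fun i : 'I_l => X (k + i)%N) ->
  forall (D : set (k.-tuple R)) (E : set (l.-tuple R)), measurable D -> measurable E ->
  P (tuple_rv (fun i : 'I_k => X i) @^-1` D `&`
     tuple_rv (fun i : 'I_l => X (k + i)%N) @^-1` E) =
  (P (tuple_rv (fun i : 'I_k => X i) @^-1` D) *
   P (tuple_rv (fun i : 'I_l => X (k + i)%N) @^-1` E))%E.
Proof.
move=> mX iX iXk iXl D E /measurable_tuple_boxes sD /measurable_tuple_boxes sE.
have pre n (Y : 'I_n -> T -> R) : (forall i, measurable_fun setT (Y i)) ->
    let G := [set tuple_rv Y @^-1` C | C in @tuple_boxes R n] in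
    [/\ G `<=` measurable, setI_closed G & G setT].
  move=> mY; split.
  - move=> _ [C bC <-]; rewrite -[X in measurable X]setTI.
    apply: measurable_tuple_rv => //; exact: tuple_boxes_measurable.
  - move=> _ _ [A bA <-] [B bB <-]; exists (A `&` B); last by rewrite preimage_setI.
    exact: tuple_boxesI.
  - by exists setT; rewrite ?preimage_setT //; exact: tuple_boxesT.
have [G1 G2 G3] := pre k (fun i : 'I_k => X i) (fun i => mX _).
have [H1 H2 H3] := pre l (fun i : 'I_l => X (k + i)%N) (fun i => mX _).
apply: (pi_system_independence G1 H1 G2 H2 G3 H3); last 2 first.
- exact: sigma_preimage.
- exact: sigma_preimage.
move=> _ _ [_ [A mA ->] <-] [_ [B mB ->] <-].
rewrite !tuple_rv_box iXk // iXl //.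
pose C (i : 'I_(k + l)) := match fintype.split i with inl j => A j | inr j => B j end.
have mC i : measurable (C i) by rewrite /C; case: splitP.
have Cl i : C (lshift l i) = A i by rewrite /C (unsplitK (inl _ i)).
have Cr i : C (rshift k i) = B i by rewrite /C (unsplitK (inr _ i)).
transitivity (P (\bigcap_(i : 'I_(k + l)) (X i @^-1` C i))).
  congr (P _); apply/seteqP; split=> w /=.
    case=> hA hB i _; rewrite /C /=; case: splitP => j ij; rewrite /preimage /= ij.
      exact: (hA j).
    exact: (hB j).
  move=> h; split=> i _.
    by have := h (lshift l i) I; rewrite Cl.
  by have := h (rshift k i) I; rewrite Cr.
rewrite iX // big_split_ord /=; congr (_ * _)%E; apply: eq_bigr => i _.
  by rewrite Cl.
by rewrite Cr.
Qed.

Lemma mutually_independent_rev d (T : measurableType d) (R : realType)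
    (P : probability T R) n (X : 'I_n -> T -> R) :
  mutually_independent P X -> mutually_independent P (fun i => X (rev_ord i)).
Proof.
move=> iX A mA.
have := iX (fun i => A (rev_ord i)) (fun i => mA _).
have -> : \bigcap_i X i @^-1` A (rev_ord i) = \bigcap_i X (rev_ord i) @^-1` A i.
  apply/seteqP; split=> w h i _.
    by have := h (rev_ord i) I; rewrite rev_ordK.
  by have := h (rev_ord i) I; rewrite /= rev_ordK.
move=> ->; rewrite (reindex_inj rev_ord_inj) /=; apply: eq_bigr => i _.
by rewrite rev_ordK.
Qed.

Lemma mutually_independent_opp d (T : measurableType d) (R : realType)
    (P : probability T R) n (X : 'I_n -> T -> R) :
  mutually_independent P X -> mutually_independent P (fun i w => - X i w).
Proof.
move=> iX A mA; apply: (iX (fun i => -%R @^-1` A i)) => i.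
by rewrite -[X in measurable X]setTI; exact: oppr_measurable.
Qed.

(** The centred density is even and Lebesgue measure is invariant under negation; [s != 0] selects
    the Gaussian branch of [normal_pdf]. *)
Lemma normal_prob_opp (R : realType) (s : R) (A : set R) : measurable A -> s != 0 ->
  normal_prob 0 s (-%R @^-1` A) = normal_prob 0 s A.
Proof.
move=> mA s0; rewrite /normal_prob.
transitivity (\int[pushforward lebesgue_measure (-%R : R -> measurableTypeR R)]_(x in A)
   (normal_pdf 0 s x)%:E)%E.
  rewrite ge0_integral_pushforward //=.
  - apply: eq_integral => x _; rewrite /= /normal_pdf (negbTE s0) /normal_fun.
    by rewrite !subr0 sqrrN.
  - by apply: measurable_funTS; apply/measurable_EFinP; exact: measurable_normal_pdf.
  - by move=> x _; rewrite lee_fin normal_pdf_ge0.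
apply: eq_measure_integral => B mB BA; exact: lebesgue_measureN.
Qed.

Lemma normal_prob_set1 (R : realType) (m s x : R) : normal_prob m s [set x] = 0%E.
Proof.
have /null_content_dominatesP := @normal_prob_dominates R m s.
by apply; [exact: measurable_set1|exact: lebesgue_measure_set1].
Qed.

(** * Gaussian walks and their ladder probabilities *)

Lemma gap_total_take_lt n (s : seq 'I_n) i j : (i < j <= size s)%N ->
  (gap_total (take i s) < gap_total (take j s))%N.
Proof.
case/andP=> ij js.
rewrite -(subnKC (ltnW ij)) takeD /gap_total big_cat /= -[X in (X < _)%N]addn0 ltn_add2l.
have : (0 < size (drop i s))%N by rewrite size_drop; lia.
case: (drop i s) => [//|x s' _]; have : (0 < j - i)%N by lia.
by case: (j - i)%N => // m _; rewrite /= big_cons.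
Qed.

Lemma gap_total_takeS n (s : seq 'I_n) (x0 : 'I_n) i : (i < size s)%N ->
  gap_total (take i.+1 s) = (gap_total (take i s) + (nth x0 s i).+1)%N.
Proof.
by move=> si; rewrite (take_nth x0 si) /gap_total -cats1 big_cat big_seq1.
Qed.

Lemma all_hitsP n (b : nat -> bool) m (s : seq 'I_n) :
  all_hits b m s <-> forall i, (i < size s)%N -> b (m + gap_total (take i.+1 s))%N.
Proof.
elim: s m => [//|x s IH] m /=; split.
  case/andP=> bx /IH H [|i] si; first by rewrite take0 /gap_total big_seq1.
  by rewrite /gap_total big_cons addnA; exact: H.
move=> H; apply/andP; split.
  by have := H 0%N isT; rewrite take0 /gap_total big_seq1.
by apply/IH => i si; have := H i.+1 si; rewrite /gap_total big_cons addnA.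
Qed.

Section GaussianWalk.
Context (R : realType) d (T : measurableType d) (P : probability T R).
Variables (B : R -> {RV P >-> R}) (B_bm : brownian_motion B).
Variables (tau : R) (tau0 : 0 < tau) (n : nat).

Definition walk (j : nat) (w : T) : R := B (j%:R * tau) w.

Definition walk_steps (s : seq 'I_n) (i : nat) (w : T) : R :=
  walk (gap_total (take i.+1 s)) w - walk (gap_total (take i s)) w.

Definition positive_sums l : set (l.-tuple R) :=
  [set y | forall i : 'I_l, 0 < \sum_(j < l | (j <= i)%N) tnth y j].

(** The reference level is [walk 0 w] rather than 0, because the motion starts at 0 only almost
    surely. *)
Definition walk_ladder (s : seq 'I_n) : set T :=
  [set w | forall i, (i < size s)%N -> walk 0 w < walk (gap_total (take i.+1 s)) w].

Definition ladder_prob (s : seq 'I_n) : R := fine (P (walk_ladder s)).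

Lemma measurable_walk j : measurable_fun setT (walk j).
Proof. exact: measurable_funP. Qed.

Lemma measurable_walk_steps s i : measurable_fun setT (walk_steps s i).
Proof. by apply: measurable_funB; exact: measurable_walk. Qed.

Lemma measurable_positive_sums l : measurable (@positive_sums l).
Proof.
rewrite (_ : @positive_sums l = \bigcap_(i in [set: 'I_l]) ((fun y : l.-tuple R =>
    \sum_(j <- seq.filter (fun j : 'I_l => (j <= i)%N) (index_enum 'I_l)) tnth y j)
      @^-1` `]0, +oo[%classic)).
  apply: fin_bigcap_measurable => // i _; rewrite -[X in measurable X]setTI.
  have : measurable_fun setT (fun y : l.-tuple R =>
      \sum_(j <- seq.filter (fun j : 'I_l => (j <= i)%N) (index_enum 'I_l)) tnth y j).
    apply: measurable_sum => j; exact: measurable_tnth.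
  by apply.
apply/seteqP; split=> y /= h i => [_|]; have := h i.
  by rewrite /= in_itv /= andbT big_filter.
by move=> /(_ I); rewrite /= in_itv /= andbT big_filter.
Qed.

(** Telescoping expresses the event through the increments alone, so its probability depends only on
    their joint law. *)
Lemma walk_ladder_tuple s :
  walk_ladder s = tuple_rv (fun i : 'I_(size s) => walk_steps s i) @^-1` @positive_sums _.
Proof.
have E w i : (i < size s)%N ->
    \sum_(j < size s | (j <= i)%N) walk_steps s j w =
    walk (gap_total (take i.+1 s)) w - walk 0 w.
  move=> si.
  rewrite -(big_ord_widen (size s) (fun j => walk_steps s j w) si).
  rewrite -(big_mkord xpredT (fun j => walk_steps s j w)).
  rewrite (telescope_sumr (fun j => walk (gap_total (take j s)) w)) //.
  by rewrite take0 /gap_total big_nil.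
apply/seteqP; split=> w h i.
  under eq_bigr do rewrite tnth_mktuple.
  by rewrite E // subr_gt0; exact: h.
move=> si; have := h (Ordinal si).
under eq_bigr do rewrite tnth_mktuple.
by rewrite /= E // subr_gt0.
Qed.

Lemma measurable_walk_ladder s : measurable (walk_ladder s).
Proof.
rewrite walk_ladder_tuple -[X in measurable X]setTI; apply: measurable_tuple_rv => //.
  by move=> i; exact: measurable_walk_steps.
exact: measurable_positive_sums.
Qed.

Lemma walk_steps_indep s k l : (k + l <= size s)%N ->
  mutually_independent P (fun i : 'I_l => walk_steps s (k + i)).
Proof.
move=> kl.
pose u (j : nat) := (gap_total (take (k + j) s))%:R * tau.
have -> : (fun i : 'I_l => walk_steps s (k + i)) =
    (fun j : 'I_l => B (u j.+1) \- B (u j)).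
  by apply/funext => i; apply/funext => w; rewrite /walk_steps /u addnS.
apply: (bm_indep B_bm).
  by rewrite mulr_ge0 // ltW.
move=> j jl; rewrite ltr_pM2r // ltr_nat gap_total_take_lt //; lia.
Qed.

(** Only the length of the gap enters, not where it occurs in the word; this is what permits
    reversing and dropping gaps. *)
Lemma walk_steps_law s i A x0 : (i < size s)%N -> measurable A ->
  P (walk_steps s i @^-1` A) =
  normal_prob 0 (Num.sqrt ((nth x0 s i).+1%:R * tau)) A.
Proof.
move=> si mA.
have lt : (gap_total (take i s) < gap_total (take i.+1 s))%N.
  by apply: gap_total_take_lt; rewrite ltnSn.
have h0 : 0 <= (gap_total (take i s))%:R * tau by rewrite mulr_ge0 // ltW.
have h1 : (gap_total (take i s))%:R * tau < (gap_total (take i.+1 s))%:R * tau.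
  by rewrite ltr_pM2r // ltr_nat.
have -> : (nth x0 s i).+1%:R * tau =
    (gap_total (take i.+1 s))%:R * tau - (gap_total (take i s))%:R * tau.
  by rewrite (gap_total_takeS x0 si) -mulrBl natrD addrAC subrr add0r.
exact: (bm_gauss B_bm h0 h1 mA).
Qed.

Lemma walk_neq (s : seq 'I_n) i j : (i < j <= size s)%N ->
  P [set w | walk (gap_total (take i s)) w = walk (gap_total (take j s)) w] = 0%E.
Proof.
move=> ij.
have h0 : 0 <= (gap_total (take i s))%:R * tau by rewrite mulr_ge0 // ltW.
have h1 : (gap_total (take i s))%:R * tau < (gap_total (take j s))%:R * tau.
  by rewrite ltr_pM2r // ltr_nat gap_total_take_lt.
have := bm_gauss B_bm h0 h1 (measurable_set1 0).
rewrite normal_prob_set1 => <-; rewrite /pushforward; congr (P _).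
apply/seteqP; split=> w /=; rewrite /walk.
  by move=> ->; rewrite subrr.
by move/eqP; rewrite subr_eq0 => /eqP.
Qed.

(* The increments read backwards, or with opposite signs, have the same joint law
   as the increments along the corresponding list of gaps. *)
Lemma prob_walk_ladder_rev s k : (k <= size s)%N ->
  P (tuple_rv (fun i : 'I_k => walk_steps s (rev_ord i)) @^-1` @positive_sums k) =
  P (walk_ladder (rev (take k s))).
Proof.
move=> ks.
have sz : size (rev (take k s)) = k by rewrite size_rev size_takel.
rewrite walk_ladder_tuple sz.
apply: mutually_independent_law; last exact: measurable_positive_sums.
- by move=> i; exact: measurable_walk_steps.
- by move=> i; exact: measurable_walk_steps.
- exact: (mutually_independent_rev (@walk_steps_indep s 0 k ks)).
- by apply: (@walk_steps_indep _ 0 k); rewrite sz.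
move=> i A mA; have ik := ltn_ord i.
have x0 : 'I_n by case: s ks sz => [|x s' _ _]; [move: k i ik => [|k] []|exact: x].
have h1 : (rev_ord i < size s)%N by rewrite /=; lia.
have h2 : (i < size (rev (take k s)))%N by rewrite sz.
rewrite (walk_steps_law x0 h1 mA) (walk_steps_law x0 h2 mA).
suff -> : nth x0 (rev (take k s)) i = nth x0 s (rev_ord i) by [].
have h3 : (k - i.+1 < k)%N by lia.
by rewrite nth_rev ?size_takel // nth_take.
Qed.

Lemma prob_walk_ladder_drop s k : (k <= size s)%N ->
  P (tuple_rv (fun (i : 'I_(size s - k)) w => - walk_steps s (k + i) w)
     @^-1` @positive_sums (size s - k)) =
  P (walk_ladder (drop k s)).
Proof.
move=> ks.
rewrite walk_ladder_tuple size_drop.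
apply: mutually_independent_law; last exact: measurable_positive_sums.
- by move=> i; apply: measurable_funN; exact: measurable_walk_steps.
- by move=> i; exact: measurable_walk_steps.
- by apply: mutually_independent_opp; apply: walk_steps_indep; rewrite subnKC.
- by apply: (@walk_steps_indep _ 0); rewrite size_drop.
move=> i A mA; have ik := ltn_ord i.
have x0 : 'I_n by case: s ks i ik => [_ i|//]; case: i.
have h1 : (i < size (drop k s))%N by rewrite size_drop.
have h2 : (k + i < size s)%N by lia.
have mNA : measurable (-%R @^-1` A).
  by rewrite -[X in measurable X]setTI; exact: oppr_measurable.
rewrite (walk_steps_law x0 h1 mA).
rewrite -[LHS]/(P (walk_steps s (k + i) @^-1` (-%R @^-1` A))) (walk_steps_law x0 h2 mNA).
have s0 : Num.sqrt ((nth x0 s (k + i)).+1%:R * tau) != 0.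
  by rewrite gt_eqF // sqrtr_gt0 mulr_gt0.
have -> : nth x0 (drop k s) i = nth x0 s (k + i) by rewrite nth_drop.
exact: (normal_prob_opp mA s0).
Qed.

(** Strict inequalities make the events for different [k] disjoint; the ties left out are null. *)
Definition peak_at (s : seq 'I_n) k : set T :=
  [set w | forall i, (i <= size s)%N -> i != k ->
    walk (gap_total (take i s)) w < walk (gap_total (take k s)) w].

Let sum_prefix l (F : nat -> R) i : (i < l)%N ->
  \sum_(j < l | (j <= i)%N) F j = \sum_(0 <= j < i.+1) F j.
Proof. by move=> il; rewrite -(big_ord_widen l F il) big_mkord. Qed.

(** Seen from the peak, the path lies below on both sides: backwards, the reversed increments have
    positive partial sums; forwards, the negated increments do. *)
Lemma peak_atE s k : (k <= size s)%N ->
  peak_at s k = tuple_rv (fun i : 'I_k => walk_steps s (rev_ord i)) @^-1` @positive_sums k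
    `&` tuple_rv (fun (i : 'I_(size s - k)) w => - walk_steps s (k + i) w)
     @^-1` @positive_sums (size s - k).
Proof.
move=> ks; pose V i w := walk (gap_total (take i s)) w.
have back w i : (i < k)%N ->
    \sum_(j < k | (j <= i)%N) walk_steps s (rev_ord j) w = V k w - V (k - i.+1)%N w.
  move=> ik; rewrite (sum_prefix (fun j => walk_steps s (k - j.+1) w) ik).
  rewrite (@telescope_sumr_eq _ _ _ (fun j => - V (k - j)%N w)) //.
    by rewrite subn0 opprK addrC.
  move=> j /andP[_ ji]; rewrite /walk_steps opprK addrC.
  by have -> : ((k - j.+1).+1 = k - j)%N by lia.
have forth w i : (i < size s - k)%N ->
    \sum_(j < size s - k | (j <= i)%N) - walk_steps s (k + j) w = V k w - V (k + i.+1)%N w.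
  move=> ik; rewrite (sum_prefix (fun j => - walk_steps s (k + j) w) ik).
  rewrite (@telescope_sumr_eq _ _ _ (fun j => - V (k + j)%N w)) //.
    by rewrite addn0 opprK addrC.
  by move=> j /andP[_ ji]; rewrite /walk_steps opprB opprK addrC addnS.
apply/seteqP; split=> w /=.
  move=> h; split=> i; under eq_bigr do rewrite tnth_mktuple.
    rewrite back // subr_gt0; apply: h; first by lia.
    by have := ltn_ord i; lia.
  rewrite forth // subr_gt0; apply: h; have := ltn_ord i; lia.
case=> h1 h2 i si; rewrite neq_ltn => /orP[ik|ki].
  have h : (k - i.+1 < k)%N by lia.
  have := h1 (Ordinal h); under eq_bigr do rewrite tnth_mktuple.
  rewrite back // subr_gt0 /V /=.
  by have -> : (k - (k - i.+1).+1 = i)%N by lia.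
have h : (i - k.+1 < size s - k)%N by lia.
have := h2 (Ordinal h); under eq_bigr do rewrite tnth_mktuple.
rewrite forth // subr_gt0 /V /=.
by have -> : (k + (i - k.+1).+1 = i)%N by lia.
Qed.

Lemma measurable_peak_at s k : (k <= size s)%N -> measurable (peak_at s k).
Proof.
move=> ks; rewrite peak_atE //; apply: measurableI;
  rewrite -[X in measurable X]setTI; apply: measurable_tuple_rv => //;
  try exact: measurable_positive_sums.
- by move=> i; exact: measurable_walk_steps.
- by move=> i; apply: measurable_funN; exact: measurable_walk_steps.
Qed.

(** The two sides of the peak depend on disjoint blocks of independent increments. *)
Lemma prob_peak_at s k : (k <= size s)%N ->
  P (peak_at s k) = (P (walk_ladder (rev (take k s))) * P (walk_ladder (drop k s)))%E.
Proof.
move=> ks; rewrite -prob_walk_ladder_rev // -prob_walk_ladder_drop // peak_atE //.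
(* Reversal and negation become measurable maps applied to the plain blocks, the form in which block
   independence applies. *)
pose revt (y : k.-tuple R) := tuple_rv (fun (i : 'I_k) (y : k.-tuple R) => tnth y (rev_ord i)) y.
pose oppt (y : (size s - k).-tuple R) := tuple_rv
  (fun (i : 'I_(size s - k)) (y : (size s - k).-tuple R) => - tnth y i) y.
have mrevt : measurable_fun setT revt.
  by apply: measurable_tuple_rv => i; exact: measurable_tnth.
have moppt : measurable_fun setT oppt.
  by apply: measurable_tuple_rv => i; apply: measurable_funN; exact: measurable_tnth.
have -> : tuple_rv (fun i : 'I_k => walk_steps s (rev_ord i)) =
    revt \o tuple_rv (fun i : 'I_k => walk_steps s i).
  by apply/funext => w; apply: eq_from_tnth => i; rewrite /= !tnth_mktuple.
have -> : tuple_rv (fun (i : 'I_(size s - k)) w => - walk_steps s (k + i) w) =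
    oppt \o tuple_rv (fun i : 'I_(size s - k) => walk_steps s (k + i)).
  by apply/funext => w; apply: eq_from_tnth => i; rewrite /= !tnth_mktuple.
rewrite !comp_preimage.
apply: mutually_independent_blocks.
- by move=> i; exact: measurable_walk_steps.
- by apply: (@walk_steps_indep s 0); rewrite add0n subnKC.
- exact: (@walk_steps_indep s 0).
- by apply: walk_steps_indep; rewrite subnKC.
- by rewrite -[X in measurable X]setTI; apply: mrevt => //; exact: measurable_positive_sums.
- by rewrite -[X in measurable X]setTI; apply: moppt => //; exact: measurable_positive_sums.
Qed.

(** Some sampled point attains the maximum, and it does so strictly unless two of the values tie,
    which has probability 0 by [walk_neq]. *)
Lemma prob_peak s : P (\big[setU/set0]_(k < (size s).+1) peak_at s k) = 1%E.
Proof.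
set E := \big[setU/set0]_(k < (size s).+1) peak_at s k.
have mE : measurable E.
  apply: bigsetU_measurable => k _; apply: measurable_peak_at.
  by rewrite -ltnS.
(* Padding with [set0] out of range allows countable unions over all indices. *)
pose Z i j : set T := if (i < j <= size s)%N then
  [set w | walk (gap_total (take i s)) w = walk (gap_total (take j s)) w] else set0.
have nZ : P.-negligible (\bigcup_i \bigcup_j Z i j).
  apply: negligible_bigcup => i; apply: negligible_bigcup => j.
  rewrite /Z; case: ifP => ij; last exact: negligible_set0.
  apply/negligibleP; last exact: walk_neq.
  have : measurable_fun setT (walk (gap_total (take i s)) \- walk (gap_total (take j s))).
    by apply: measurable_funB; exact: measurable_walk.
  move=> /(_ measurableT [set 0] (measurable_set1 0)); rewrite setTI.
  congr measurable; apply/seteqP; split=> w /=.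
    by move/eqP; rewrite subr_eq0 => /eqP.
  by move=> ->; rewrite subrr.
have nE : P (~` E) = 0%E.
  apply: measure_negligible; first exact: measurableC.
  apply: negligibleS nZ => w nEw; apply: contrapT => nZw; apply: nEw.
  pose V (i : 'I_(size s).+1) := walk (gap_total (take i s)) w.
  have : exists k : 'I_(size s).+1, forall i, V i <= V k.
    by case: (arg_maxP V (i0 := ord0) (P := xpredT) isT) => k _ kmax; exists k => i; exact: kmax.
  case=> k kmax; rewrite /E -bigcup_mkord; exists k; first by rewrite /=.
  move=> i si ik; rewrite lt_neqAle (kmax (Ordinal (si : (i < (size s).+1)%N))) andbT.
  apply/eqP => Vik; apply: nZw.
  move: ik; rewrite neq_ltn => /orP[ik|ki].
    exists i => //; exists k => //; rewrite /Z ik /=.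
    by have -> : (k <= size s)%N by rewrite -ltnS.
  by exists (k : nat) => //; exists i => //; rewrite /Z ki si.
by rewrite -(setCK E) probability_setC ?nE ?sube0 //; exact: measurableC.
Qed.

Lemma ladder_prob_sum s :
  \sum_(k < (size s).+1) ladder_prob (rev (take k s)) * ladder_prob (drop k s) = 1.
Proof.
apply: EFin_inj; rewrite -(prob_peak s) measure_bigsetU_ord; last 2 first.
- by move=> k; apply: measurable_peak_at; exact: leq_ord.
- apply/trivIsetP => i j _ _ ij; apply/seteqP; split=> // w [hi hj].
  have iji : nat_of_ord i != j by rewrite val_eqE.
  have := hi j (leq_ord j); rewrite eq_sym => /(_ iji) h.
  by have := lt_trans h (hj i (leq_ord i) iji); rewrite ltxx.
rewrite -sumEFin; apply: eq_bigr => k _.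
apply: etrans; last by apply/esym/prob_peak_at; exact: leq_ord.
by rewrite EFinM /ladder_prob !fineK // fin_num_measure //; exact: measurable_walk_ladder.
Qed.

Lemma ladder_prob_nil : ladder_prob [::] = 1.
Proof.
rewrite /ladder_prob (_ : walk_ladder [::] = setT) ?probability_setT //.
by apply/seteqP; split=> // w _ i.
Qed.

Lemma integral_wsum (D : finType) r (A : seq D -> set T) :
  (forall s, measurable (A s)) ->
  measurable_fun setT (fun w => wsum r (fun s => \1_(A s) w : R)) /\
  (\int[P]_w (wsum r (fun s => \1_(A s) w : R))%:E = (wsum r (fun s => fine (P (A s))))%:E)%E.
Proof.
have ge0 l (C : seq D -> set T) w : 0 <= wsum l (fun s => \1_(C s) w : R).
  by elim: l C => [|l IH] C //=; apply: sumr_ge0 => x _; exact: IH.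
elim: r A => [|r IH] A mA /=.
  split; first exact: measurable_indic.
  by rewrite integral_indic // setIT fineK // fin_num_measure.
have IHx x := IH (fun s => A (x :: s)) (fun s => mA _).
split.
  by apply: measurable_sum => x; exact: (IHx x).1.
rewrite -sumEFin; under [RHS]eq_bigr => x _ do rewrite -(IHx x).2.
rewrite -ge0_integral_sum //.
- by apply: eq_integral => w _; rewrite sumEFin.
- by move=> x; apply/measurable_EFinP; exact: (IHx x).1.
- by move=> x w _; rewrite lee_fin; exact: ge0.
Qed.

(** The comparison is strict although [sojourn_time] uses the closed half-line: the zeros of the
    path will be negligible. *)
Definition positive_count (w : T) : nat := \sum_(1 <= j < n.+1) (walk 0 w < walk j w)%R.

Lemma positive_count_le w : (positive_count w <= n)%N.
Proof.
rewrite -[X in (_ <= X)%N](_ : \sum_(1 <= j < n.+1) 1 = n)%N.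
  by apply: leq_sum => i _; case: (_ < _).
by rewrite sum_nat_const_nat; lia.
Qed.

(** [wsum_hits] writes the binomial as a sum of ladder indicators over words; integration turns
    these into [ladder_prob], and [wsum_ladder_gaps] evaluates the sum. *)
Lemma measurable_bin_positive_count r :
  measurable_fun setT (fun w => ('C(positive_count w, r))%:R : R) /\
  (\int[P]_w (('C(positive_count w, r))%:R : R)%:E =
  (arcsine_moment R r * ('C(n, r))%:R)%:E)%E.
Proof.
pose A (s : seq 'I_n) := if (gap_total s <= n)%N then walk_ladder s else set0.
have mA s : measurable (A s).
  by rewrite /A; case: ifP => // _; exact: measurable_walk_ladder.
have E w : ('C(positive_count w, r))%:R = wsum r (fun s => \1_(A s) w : R).
  rewrite -(@wsum_hits n R (fun j => walk 0 w < walk j w) r 0) //.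
  apply: eq_wsum => s _; rewrite /A add0n; case: ifP => _; last by rewrite andbF indic0.
  rewrite andbT indicE; congr (_ %:R); congr nat_of_bool.
  by apply/idP/idP => [/all_hitsP h|]; [rewrite inE|rewrite inE => h; apply/all_hitsP].
have [h1 h2] := integral_wsum r mA.
split; first by apply: eq_measurable_fun h1 => w _; rewrite E.
under eq_integral do rewrite E.
rewrite h2; congr EFin.
rewrite -(@wsum_ladder_gaps n R ladder_prob (arcsine_moment R)).
- apply: eq_wsum => s _; rewrite /A /ladder_prob.
  by case: ifP => _; rewrite ?mulr1 ?mulr0 // measure0.
- by rewrite pnatr_eq0.
- by rewrite /arcsine_moment bin0 expr0 divr1.
- exact: sum_arcsine_moment.
- exact: ladder_prob_nil.
- exact: ladder_prob_sum.
Qed.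

End GaussianWalk.

(** * Measurability of occupation times *)

Section BoundedConvergence.
Context d (T : measurableType d) (R : realType) (mu : {measure set T -> \bar R}).
Variables (D : set T) (mD : measurable D) (muD : (mu D < +oo)%E).

Lemma bounded_integrable (f : T -> R) (M : R) : measurable_fun D f ->
  (forall x, D x -> `|f x| <= M) -> mu.-integrable D (EFin \o f).
Proof.
move=> mf fM; apply: measurable_bounded_integrable => //.
exists M; split; first exact: num_real.
by move=> y My x Dx; apply: le_trans (fM x Dx) _; exact: ltW.
Qed.

Lemma bounded_Rintegral_cvg (f_ : nat -> T -> R) (f : T -> R) (M : R) :
  (forall n, measurable_fun D (f_ n)) -> measurable_fun D f ->
  {ae mu, forall x, D x -> f_ ^~ x @ \oo --> f x} ->
  (forall n x, D x -> `|f_ n x| <= M) ->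
  \int[mu]_(x in D) f_ n x @[n --> \oo] --> \int[mu]_(x in D) f x.
Proof.
move=> mf_ mf cf bf.
have iM : mu.-integrable D (EFin \o cst M).
  by apply: (@bounded_integrable _ `|M|) => //; exact: measurable_cst.
have [|||||i1 _ i2] := @dominated_convergence _ _ _ mu D mD
  (fun n x => (f_ n x)%:E) (fun x => (f x)%:E) (cst M%:E).
- by move=> n; apply/measurable_EFinP; exact: mf_.
- by apply/measurable_EFinP.
- by apply: filterS cf => x h Dx; apply: cvg_EFin; [exact: nearW|exact: h].
- exact: iM.
- by apply: aeW => x n Dx; rewrite lee_fin; exact: bf.
apply: fine_cvg; rewrite fineK //.
exact: integrable_fin_num.
Qed.

End BoundedConvergence.

(** For [0 <= s], the first multiple of [m.+1%:R^-1] strictly beyond [s]; strictness lets right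
    continuity apply along the grid. As [Num.truncn] is 0 on negative reals, negative times go to
    the first positive grid point. *)
Definition right_grid {R : realType} (m : nat) (s : R) : R :=
  (Num.truncn (s * m.+1%:R)).+1%:R / m.+1%:R.

Section RightGrid.
Context (R : realType).
Implicit Types s : R.

Lemma right_grid_gt m s : 0 <= s -> s < right_grid m s.
Proof. by move=> s0; rewrite ltr_pdivlMr // truncnS_gt. Qed.

Lemma right_grid_gt0 m s : 0 < right_grid m s.
Proof. by rewrite divr_gt0. Qed.

Lemma right_grid_le m s : 0 <= s -> right_grid m s <= s + m.+1%:R^-1.
Proof.
move=> s0; rewrite ler_pdivrMr // mulrDl mulVf // -natr1 lerD2r.
by rewrite truncn_le // mulr_ge0.
Qed.

Lemma right_grid_neg m s : s <= 0 -> right_grid m s = m.+1%:R^-1.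
Proof.
move=> s0; rewrite /right_grid (_ : Num.truncn _ = 0%N) ?mul1r //.
apply/eqP; rewrite -leqn0 truncn_le_nat.
by rewrite (le_lt_trans _ (ltr0n _ 1)) // mulr_le0_ge0.
Qed.

Lemma right_grid_cvg s : 0 <= s -> right_grid m s @[m --> \oo] --> s.
Proof.
move=> s0; apply: (squeeze_cvgr (f := cst s) (h := fun m => s + m.+1%:R^-1)).
- by apply: nearW => m /=; rewrite right_grid_le // ltW // right_grid_gt.
- exact: cvg_cst.
- rewrite -[X in _ --> X]addr0; apply: cvgD; first exact: cvg_cst.
  exact: cvg_harmonic.
Qed.

Lemma measurable_truncn_eq (c : R) k : measurable [set s : R | Num.truncn (s * c) = k].
Proof.
have mle j : measurable [set s : R | (Num.truncn (s * c) <= j)%N].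
  rewrite (_ : [set _ | _] = (fun s => s * c) @^-1` `]-oo, j.+1%:R[%classic).
    have : measurable_fun setT (fun s : R => s * c) by exact: mulrr_measurable.
    by move=> /(_ measurableT _ (measurable_itv `]-oo, j.+1%:R[)); rewrite setTI.
  by apply/seteqP; split=> s; rewrite /= in_itv /= truncn_le_nat.
case: k => [|k].
  rewrite (_ : [set _ | _] = [set s : R | (Num.truncn (s * c) <= 0)%N]) //.
  by apply/seteqP; split=> s /=; rewrite leqn0 => /eqP.
rewrite (_ : [set _ | _] = [set s : R | (Num.truncn (s * c) <= k.+1)%N] `\`
  [set s : R | (Num.truncn (s * c) <= k)%N]); first exact: measurableD.
apply/seteqP; split=> s /=; first by move=> ->; rewrite ltnn.
by case=> h1 /negP h2; apply/eqP; rewrite eqn_leq h1 /=; lia.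
Qed.

End RightGrid.

Lemma continuous_half_line (R : realType) (f : R -> R) s e :
  {within `[0, +oo[, continuous f} -> 0 <= s -> 0 < e ->
  exists2 delta, 0 < delta &
    forall s', 0 <= s' -> `|s' - s| < delta -> `|f s' - f s| < e.
Proof.
move=> /subspace_continuousP /(_ s) cf s0 e0.
have /cf /cvgrPdist_lt /(_ e e0) : [set` `[0, +oo[] s by rewrite /= in_itv /= s0.
rewrite near_withinE => /nbhs_ballP[delta /= d0 H].
exists delta => // s' s'0 ss'; rewrite distrC; apply: H; last by rewrite /= in_itv /= s'0.
by rewrite /ball /= distrC.
Qed.

Section PathMeasurability.
Context (R : realType) d (T : measurableType d) (X : R -> T -> R).
Hypothesis mX : forall s, 0 <= s -> measurable_fun setT (X s).
Hypothesis cX : forall w, {within `[0, +oo[, continuous (fun s => X s w)}.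

(* Only nonnegative times are constrained, hence [Num.max 0]. *)
Lemma measurable_path :
  measurable_fun setT (fun p : measurableTypeR R * T => X (Num.max 0 p.1) p.2).
Proof.
(* Sampled at [right_grid], the path has preimages that are countable unions of measurable
   rectangles; continuity then gives the pointwise limit. *)
apply: (measurable_fun_cvg (h := fun m (p : measurableTypeR R * T) =>
    X (right_grid m p.1) p.2)) => [m|[s w] _ /=].
  move=> _ A mA; rewrite setTI.
  rewrite (_ : _ @^-1` A = \bigcup_k
      ([set s : R | Num.truncn (s * m.+1%:R) = k] `*` X (k.+1%:R / m.+1%:R) @^-1` A)).
    apply: bigcupT_measurable => k; apply: measurableX.
      exact: measurable_truncn_eq.
    by rewrite -[X in measurable X]setTI; apply: mX.
  apply/seteqP; split=> [[s w]|[s w] [k _ [/= <- //]]].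
  by rewrite /= => h; exists (Num.truncn (s * m.+1%:R)).
have gcvg : right_grid m s @[m --> \oo] --> Num.max 0 s.
  have [s0|s0] := leP 0 s; first exact: right_grid_cvg.
  rewrite (_ : (fun m => _) = (fun m => m.+1%:R^-1)); first exact: cvg_harmonic.
  by apply/funext => m; rewrite right_grid_neg // ltW.
have ms0 : 0 <= Num.max 0 s by rewrite le_max lexx.
apply/cvgrPdist_lt => e e0.
have [delta d0 H] := continuous_half_line (@cX w) ms0 e0.
have /cvgrPdist_lt /(_ delta d0) := gcvg.
apply: filterS => m md; rewrite distrC; apply: H; last by rewrite distrC.
by rewrite ltW // right_grid_gt0.
Qed.

(* [sojourn_time] over an arbitrary measurable space, so that it can be used with the
   sigma-algebra generated by the Brownian motion. *)
Definition time_above (t : R) (w : T) : R :=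
  \int[lebesgue_measure]_(s in `[0, t]) \1_(`[0, +oo[) (X s w).

Lemma measurable_path_indic (t : R) (A : set R) : measurable A ->
  measurable_fun setT (fun p : measurableTypeR R * T =>
    (\1_(`[0, t] `*` setT) p * \1_A (X (Num.max 0 p.1) p.2))%:E : \bar R).
Proof.
move=> mA; apply/measurable_EFinP; apply: measurable_funM.
  by apply: measurable_indic; exact: measurableX.
apply: (measurableT_comp (f := \1_A : R -> R)); first exact: measurable_indic.
exact: measurable_path.
Qed.

(** Recasts an occupation time as the integral over the whole line of a jointly measurable
    nonnegative function, ready for Tonelli. *)
Lemma time_inE (t : R) (A : set R) w : 
  (\int[lebesgue_measure]_(s in `[0%R, t]) (\1_A (X s w))%:E =
   \int[lebesgue_measure]_s
     (\1_(`[0, t] `*` setT) (s, w) * \1_A (X (Num.max 0 s) w))%R%:E)%E.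
Proof.
rewrite integral_mkcond; apply: eq_integral => s _; rewrite patchE.
case: ifPn => hs.
  have s0 : 0 <= s by move: hs; rewrite inE /= in_itv /= => /andP[].
  rewrite (max_idPr s0) (_ : \1_(_ `*` _) _ = 1) ?mul1r //.
  by rewrite indicE mem_set //; split => //; exact/set_mem.
rewrite (_ : \1_(_ `*` _) _ = 0) ?mul0r // indicE memNset // => -[h _].
by move: hs; rewrite mem_set.
Qed.

Lemma measurable_time_above t : measurable_fun setT (time_above t).
Proof.
rewrite /time_above /Rintegral; apply: measurableT_comp => //.
apply: (eq_measurable_fun (fubini_G (T1 := measurableTypeR R) lebesgue_measure
  (fun p : measurableTypeR R * T =>
    (\1_(`[0, t] `*` setT) p * \1_(`[0, +oo[) (X (Num.max 0 p.1) p.2))%:E : \bar R))).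
  by move=> w _; rewrite /fubini_G time_inE.
apply: measurable_fun_fubini_tonelli_G.
  exact: measurable_path_indic.
by move=> p; rewrite lee_fin mulr_ge0.
Qed.

End PathMeasurability.

Section RealPath.
Context (R : realType).
Notation mu := (@lebesgue_measure R).

(** Each cell carries the value at its right endpoint, so the integral is the Riemann sum over
    [j = 1, ..., n]. *)
Definition step_indicator (b : nat -> bool) (tau : R) (n : nat) (s : R) : R :=
  \sum_(j < n) (b j.+1)%:R * \1_(`]j%:R * tau, j.+1%:R * tau]) s.

Lemma measurable_step_indicator b tau n : measurable_fun setT (step_indicator b tau n).
Proof.
by apply: measurable_sum => j; apply: measurable_funM => //; exact: measurable_indic.
Qed.

Lemma integral_step_indicator b tau n : 0 < tau ->
  \int[mu]_(s in `[0, n%:R * tau]) step_indicator b tau n s =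
  (\sum_(1 <= j < n.+1) b j)%N%:R * tau.
Proof.
move=> tau0; rewrite /Rintegral /step_indicator.
have -> : (\int[mu]_(x in `[0%R, (n%:R * tau)%R])
     (\sum_(j < n) (b j.+1)%:R * \1_(`](j%:R * tau)%R, (j.+1%:R * tau)%R]) x)%R%:E =
  \sum_(j < n) ((b j.+1)%:R * tau)%:E)%E.
  under eq_integral do rewrite -sumEFin.
  rewrite ge0_integral_sum //.
  - apply: eq_bigr => j _; under eq_integral do rewrite EFinM.
    rewrite ge0_integralZl //; last first.
      by apply/measurable_EFinP; apply: measurable_indic.
    rewrite integral_indic // EFinM; congr (_ * _)%E.
    rewrite setIidl; last first.
      move=> s /=; rewrite !in_itv /= => /andP[js sj]; apply/andP; split.
        by apply: le_trans (ltW js); rewrite mulr_ge0 // ltW.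
      by apply: le_trans sj _; rewrite ler_pM2r // ler_nat.
    apply: etrans; first exact: lebesgue_measure_itv.
    rewrite /= lte_fin ltr_pM2r // ltr_nat ltnSn.
    by rewrite -EFinB -mulrBl -natr1 addrAC subrr add0r mul1r.
  - by move=> j; apply/measurable_EFinP; apply: measurable_funM.
by rewrite sumEFin /= -big_distrl /= -natr_sum big_add1 big_mkord.
Qed.

Lemma step_indicatorE b (tau : R) n (s : R) j : 0 < tau -> (j < n)%N ->
  j%:R * tau < s <= j.+1%:R * tau -> step_indicator b tau n s = (b j.+1)%:R.
Proof.
move=> tau0 jn /andP[js sj].
rewrite /step_indicator (bigD1 (Ordinal jn)) //= big1 ?addr0.
  by rewrite indicE mem_set ?mulr1 //= in_itv /= js.
move=> i ij; rewrite indicE memNset ?mulr0 //= in_itv /= => /andP[h1 h2].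
have /(_ _ _) := @ltr_pM2r R tau tau0 => lt.
have : (i%:R : R) < j.+1%:R by rewrite -lt; exact: lt_le_trans h1 sj.
have : (j%:R : R) < i.+1%:R by rewrite -lt; exact: lt_le_trans js h2.
by rewrite !ltr_nat => h3 h4; move: ij; rewrite -val_eqE /=; lia.
Qed.

Lemma step_locate (tau : R) n (s : R) : 0 < tau -> 0 < s <= n%:R * tau ->
  exists2 j, (j < n)%N & j%:R * tau < s <= j.+1%:R * tau.
Proof.
move=> tau0; elim: n => [|n IH] /andP[s0 sn].
  by have := lt_le_trans s0 sn; rewrite mul0r ltxx.
have [sn'|ns] := leP s (n%:R * tau).
  have [|j jn jP] := IH; first by rewrite s0.
  by exists j => //; exact: ltnW.
by exists n => //; rewrite ns.
Qed.

Lemma step_indicator_bound b (tau : R) n (s : R) : 0 < tau -> 0 <= s <= n%:R * tau ->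
  `|step_indicator b tau n s| <= 1.
Proof.
move=> tau0 /andP[]; rewrite le_eqVlt => /predU1P[<- _|s0 sn].
  rewrite /step_indicator big1 ?normr0 // => j _.
  rewrite indicE memNset ?mulr0 //= in_itv /= => /andP[+ _].
  by rewrite ltNge mulr_ge0 // ltW.
have [|j jn jP] := @step_locate tau n s tau0; first by rewrite s0.
by rewrite (step_indicatorE _ tau0 jn jP); case: (b _); rewrite ?normr1 ?normr0.
Qed.

(** At almost every [s] the path is nonzero, so its sign is constant near [s] and the step
    functions, all bounded by 1, are eventually equal to the indicator at [s]. *)
Lemma riemann_positive_time (y : R -> R) (t : R) : 0 < t ->
  {within `[0, +oo[, continuous y} ->
  {ae mu, forall s, `[0, t]%classic s -> y s != 0} ->
  (\sum_(1 <= j < n.+2) (0 < y (j%:R * (t / n.+1%:R)))%R)%N%:R * (t / n.+1%:R) @[n --> \oo]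
  --> \int[mu]_(s in `[0, t]) \1_(`[0, +oo[) (y s).
Proof.
move=> t0 cy y0.
pose b n j := 0 < y (j%:R * (t / n.+1%:R)).
have tau0 n : 0 < t / n.+1%:R by rewrite divr_gt0.
have ntau n : n.+1%:R * (t / n.+1%:R) = t by rewrite mulrC divfK.
have E n : (\sum_(1 <= j < n.+2) b n j)%N%:R * (t / n.+1%:R) =
    \int[mu]_(s in `[0, t]) step_indicator (b n) (t / n.+1%:R) n.+1 s.
  by have := integral_step_indicator (b n) n.+1 (tau0 n); rewrite ntau => ->.
rewrite (_ : (fun n => _) = (fun n => \int[mu]_(s in `[0, t])
   step_indicator (b n) (t / n.+1%:R) n.+1 s)); last by apply/funext => n; rewrite -E.
have my : measurable_fun `[0, t] y.
  apply: subspace_continuous_measurable_fun => //.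
  apply: continuous_subspaceW cy => s /=; rewrite !in_itv /= => /andP[-> _] //.
apply: (@bounded_Rintegral_cvg _ _ _ mu _ _ _ _ _ 1) => //.
- rewrite [X in (X < _)%E](_ : _ = t%:E) ?ltry //; apply: etrans; first exact: lebesgue_measure_itv.
  by rewrite /= lte_fin t0 oppr0 adde0.
- by move=> n; apply: measurable_funTS; exact: measurable_step_indicator.
- by apply: (measurableT_comp (f := \1_`[0, +oo[ : R -> R)) => //; exact: measurable_indic.
(* Time 0 belongs to no cell and is discarded as a null set. *)
- have ae0 : {ae mu, forall s, s != 0}.
    exists [set 0]; split => //; first exact: lebesgue_measure_set1.
    by move=> s /=; case: eqP.
  apply: (filterS2 (ae_filter_ringOfSetsType mu) _ y0 ae0) => s ys sn0 st.
  have /andP[s0 sle] : 0 < s <= t.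
    by move: st; rewrite /= in_itv /= le_eqVlt eq_sym (negbTE sn0).
  have ns := ys st.
  have [delta d0 H] : exists2 delta, 0 < delta &
      forall s', 0 <= s' -> `|s' - s| < delta -> (0 < y s') = (0 <= y s).
    (* A deviation smaller than [|y s|] cannot change the sign. *)
    have ay0 : 0 < `|y s| by rewrite normr_gt0.
    have [delta d0 H] := continuous_half_line cy (ltW s0) ay0.
    exists delta => // s' s'0 /(H _ s'0).
    rewrite ltr_norml; have [ys0|ys0] := ltrP (y s) 0.
      rewrite ltr0_norm //; lra.
    rewrite ger0_norm //; lra.
  rewrite /= indicE.
  have cv : (t / n.+1%:R) @[n --> \oo] --> (0 : R).
    by rewrite -(mulr0 t); apply: cvgM; [exact: cvg_cst|exact: cvg_harmonic].
  apply: cvg_near_cst; move/cvgrPdist_lt : cv => /(_ delta d0).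
  apply: filterS => n; rewrite sub0r normrN gtr0_norm // => nd.
  have [|j jn jP] := @step_locate (t / n.+1%:R) n.+1 s (tau0 n).
    by rewrite s0 ntau.
  rewrite (step_indicatorE _ (tau0 n) jn jP) /b H.
  + congr (nat_of_bool _)%:R.
    by apply/idP/idP; rewrite inE /= in_itv /= andbT.
  + by rewrite mulr_ge0 // ltW.
  + case/andP: jP => j1 j2; rewrite ger0_norm ?subr_ge0 //.
    apply: le_lt_trans nd; rewrite lerBlDr.
    by rewrite -[j.+1%:R]natr1 mulrDl mul1r addrC lerD2l ltW.
- move=> n s st; apply: step_indicator_bound => //; rewrite ntau.
  by move: st; rewrite /= in_itv.
Qed.

End RealPath.

(** * Arcsine moments of the Brownian sojourn time *)

Lemma indic_le1 T (R : realType) (A : set T) x : \1_A x <= 1 :> R.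
Proof. by rewrite indicE; case: (_ \in _). Qed.

Section BrownianSojourn.
Context (R : realType) d (T : measurableType d) (P : probability T R).
Variables (B : R -> {RV P >-> R}) (B_bm : brownian_motion B).
Variables (t : R) (t0 : 0 < t).
Notation mu := (@lebesgue_measure R).

(** Increments from time 0 have exactly the law given by [bm_gauss]; [B s] equals them only almost
    surely. *)
Let Y (s : R) (w : T) : R := B s w - B 0 w.

Let mY s : measurable_fun setT (Y s).
Proof. by apply: measurable_funB; exact: measurable_funP. Qed.

Let cY w : {within `[0, +oo[, continuous (fun s => Y s w)}.
Proof.
by move=> x; apply: cvgB; [exact: (bm_cont B_bm (w := w))|exact: cvg_cst].
Qed.

Let Y_neq0 s : 0 < s -> P [set w | Y s w = 0] = 0%E.
Proof.
move=> s0; have := bm_gauss B_bm (lexx 0) s0 (measurable_set1 0).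
by rewrite normal_prob_set1.
Qed.

(** By Tonelli, the expected Lebesgue measure of the zero set is the integral over [s] of the
    probability that [Y s = 0], which vanishes for every [s > 0]. *)
Lemma brownian_zero_set :
  {ae P, forall w, {ae mu, forall s, `[0, t]%classic s -> B s w - B 0 w != 0}}.
Proof.
pose f := fun p : measurableTypeR R * T =>
   (\1_(`[0, t] `*` setT) p * \1_[set 0] (Y (Num.max 0 p.1) p.2))%:E : \bar R.
have mf : measurable_fun setT f.
  by apply: measurable_path_indic => //; exact: measurable_set1.
have f0 p : (0 <= f p)%E by rewrite lee_fin mulr_ge0.
have F0 : (\int[P]_w \int[mu]_s f (s, w) = 0)%E.
  rewrite -(fubini_tonelli (m1 := mu) (m2 := P)) //.
  rewrite -[RHS](integral0 mu setT).
  apply: ae_eq_integral => //.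
    exact: (measurable_fun_fubini_tonelli_F (m2 := P) f).
  (* [Y 0] is identically 0, so time 0 has to be discarded. *)
  exists [set 0]; split; [exact: measurable_set1|exact: lebesgue_measure_set1|].
  move=> s /= /not_implyP[_ ns]; apply: contrapT => s0; apply: ns.
  have [sneg|spos|s00] := ltrgtP s 0; last by case: s0.
    rewrite (_ : (fun _ => _) = cst 0%E) ?integral0 //.
    apply/funext => w; rewrite /f /= [X in (X * _)%R]indicE memNset ?mul0r //.
    by case; rewrite /= in_itv /= => /andP[]; rewrite leNgt sneg.
  apply/eqP; rewrite eq_le; apply/andP; split; last by apply: integral_ge0.
  rewrite -(Y_neq0 spos) -[X in (_ <= P X)%E]setIT -integral_indic //; last first.
    by rewrite -[X in measurable X]setTI; exact: (@mY s measurableT _ (measurable_set1 0)).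
  apply: ge0_le_integral => //.
  - exact: (measurable_fun_pair2 s mf).
  - apply/measurable_EFinP; apply: measurable_indic.
    by rewrite -[X in measurable X]setTI; exact: (@mY s measurableT _ (measurable_set1 0)).
  - move=> w _; rewrite lee_fin /= (max_idPr (ltW spos)).
    rewrite [leRHS](_ : _ = \1_[set 0] (Y s w)) // ler_piMl //.
have mG : measurable_fun setT (fun w => \int[mu]_s f (s, w))%E.
  exact: (measurable_fun_fubini_tonelli_G (m1 := mu) f).
have G0 w : (0 <= \int[mu]_s f (s, w))%E by exact: integral_ge0.
(* A nonnegative function with zero integral vanishes almost everywhere: this is used in [w] first,
   then in [s] along almost every path. *)
have /(ae_eq_integral_abs P measurableT mG) : (\int[P]_w `|\int[mu]_s f (s, w)| = 0)%E.
  by rewrite -[RHS]F0; apply: eq_integral => w _; rewrite gee0_abs.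
apply: (@filterS _ _ (ae_filter_ringOfSetsType P)) => w /(_ I) Gw.
have mfw : measurable_fun setT (fun s : measurableTypeR R => f (s, w)).
  exact: (measurable_fun_pair1 w mf).
have /(ae_eq_integral_abs mu measurableT mfw) : (\int[mu]_s `|f (s, w)| = 0)%E.
  by rewrite -[RHS]Gw; apply: eq_integral => s _; rewrite gee0_abs.
apply: (@filterS _ _ (ae_filter_ringOfSetsType mu)) => s /(_ I) fs st.
apply/eqP => Bs; move: fs; rewrite /f /=.
have s0 : 0 <= s by move: st; rewrite /= in_itv /= => /andP[].
rewrite (max_idPr s0) !indicE !mem_set //= => -[] /eqP.
by rewrite mulr1 oner_eq0.
Qed.

Lemma cvg_positive_count : {ae P, forall w,
  (positive_count B (t / n.+1%:R) n.+1 w)%:R / n.+1%:R @[n --> \oo]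
  --> sojourn_time B t w / t}.
Proof.
apply: (filterS2 (ae_filter_ringOfSetsType P) _ brownian_zero_set (bm_start B_bm)) => w nz B0.
have := riemann_positive_time t0 (@cY w) nz.
have -> : \int[mu]_(s in `[0, t]) \1_`[0, +oo[ (Y s w) = sojourn_time B t w.
  by apply: eq_Rintegral => s _; rewrite /Y B0 subr0.
move=> cv.
rewrite (_ : (fun n => _) = (fun n => (\sum_(1 <= j < n.+2)
   (0 < B (j%:R * (t / n.+1%:R)) w - B 0 w)%R)%:R * (t / n.+1%:R) / t)).
  by apply: cvgM cv _; exact: cvg_cst.
apply/funext => n.
have -> : (positive_count B (t / n.+1%:R) n.+1 w) = (\sum_(1 <= j < n.+2)
   (0 < B (j%:R * (t / n.+1%:R)) w - B 0 w)%R)%N.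
  by apply: eq_bigr => j _; rewrite /walk mul0r subr_gt0.
by rewrite -mulrA mulrAC divff ?mul1r // gt_eqF.
Qed.

Lemma measurable_sojourn_time : measurable_fun setT (sojourn_time B t).
Proof.
apply: (measurable_time_above (X := fun s => B s)).
  by move=> s _; exact: measurable_funP.
exact: bm_cont B_bm.
Qed.

Lemma sojourn_time_bounds w : 0 <= sojourn_time B t w <= t.
Proof.
have mut : mu `[0, t]%classic = t%:E.
  apply: etrans; first exact: lebesgue_measure_itv.
  by rewrite /= lte_fin t0 oppr0 adde0.
have mut' : (mu `[0%R, t]%classic < +oo)%E by rewrite mut ltry.
apply/andP; split; first by apply: Rintegral_ge0 => s _.
rewrite /sojourn_time -[leRHS]mul1r.
have -> : 1 * t = \int[mu]_(s in `[0, t]) 1.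
  rewrite Rintegral_cst //; congr (1 * _); exact: (esym (congr1 fine mut)).
have mB : measurable_fun `[0, t] (fun s => \1_(`[0, +oo[) (B s w) : R).
  apply: (measurableT_comp (f := \1_`[0, +oo[ : R -> R)); first exact: measurable_indic.
  apply: subspace_continuous_measurable_fun => //.
  apply: continuous_subspaceW (bm_cont B_bm (w := w)) => s /=.
  by rewrite !in_itv /= => /andP[-> _].
apply: le_Rintegral => //.
- apply: (@bounded_integrable _ _ _ mu _ _ mut' _ 1) => // s _.
  by rewrite indicE; case: (_ \in _); rewrite ?normr0 ?normr1.
- by apply: (@bounded_integrable _ _ _ mu _ _ mut' _ 1) => // s _; rewrite normr1.
Qed.

Lemma sojourn_ratio_bounds w : 0 <= sojourn_time B t w / t <= 1.
Proof.
have /andP[s0 st] := sojourn_time_bounds w.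
by apply/andP; split; [exact: divr_ge0 s0 (ltW t0)|rewrite ler_pdivrMr // mul1r].
Qed.

Lemma measurable_sojourn_ratio : measurable_fun setT (fun w => sojourn_time B t w / t).
Proof. by apply: measurable_funM => //; exact: measurable_sojourn_time. Qed.

End BrownianSojourn.

Lemma ffact_leq_exp n m : (n ^_ m <= n ^ m)%N.
Proof.
elim: m => // m IH; rewrite ffactnSr expnSr.
by apply: leq_mul => //; exact: leq_subr.
Qed.

(** The quotient is the product of [(k n - i) / n.+1] over [i < r], and each factor tends to [x]. *)
Lemma falling_ratio_cvg (R : realType) (k : nat -> nat) (x : R) r :
  (k n)%:R / n.+1%:R @[n --> \oo] --> x ->
  (r`! * 'C(k n, r))%:R / n.+1%:R ^+ r @[n --> \oo] --> x ^+ r.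
Proof.
move=> kx; elim: r => [|r IH].
  rewrite expr0 (_ : (fun n => _) = cst 1); first exact: cvg_cst.
  by apply/funext => n; rewrite fact0 bin0 expr0 divr1.
rewrite (_ : (fun n => _) = (fun n => (r`! * 'C(k n, r))%:R / n.+1%:R ^+ r *
   ((k n)%:R / n.+1%:R - r%:R * n.+1%:R^-1))); last first.
  apply/funext => n; rewrite -mulrBl mulrACA -invfM -exprSr; congr (_ / _).
  rewrite factS mulnC mulnA [('C(_, _) * _)%N]mulnC mul_bin_left.
  (* Below [r] the natural subtraction truncates, but the binomial is then 0. *)
  have [kr|kr] := ltnP (k n) r.
    by rewrite bin_small // !muln0 ?mul0n mul0r.
  by rewrite -mulnA mulnC natrM natrB // mulnC.
rewrite exprSr; apply: cvgM => //.
rewrite -[X in _ --> X]subr0 -(mulr0 r%:R); apply: cvgB => //.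
by apply: cvgM; [exact: cvg_cst|exact: cvg_harmonic].
Qed.

Section ArcsineMoments.
Context (R : realType) d (T : measurableType d) (P : probability T R).
Variables (B : R -> {RV P >-> R}) (B_bm : brownian_motion B).
Variables (t : R) (t0 : 0 < t).

Let PT : (P setT < +oo)%E.
Proof. by rewrite probability_setT ltry. Qed.

Lemma Rintegral_sum n (f : 'I_n -> T -> R) :
  (forall i, P.-integrable setT (EFin \o f i)) ->
  \int[P]_w (\sum_(i < n) f i w) = \sum_(i < n) \int[P]_w f i w.
Proof.
move=> fi; rewrite /Rintegral.
under eq_integral do rewrite -sumEFin.
rewrite integral_sum //= -sum_fine // => i _.
by apply: integrable_fin_num => //; exact: fi.
Qed.

(** The scaled binomials [g n] lie in [[0, 1]] and tend to the [r]-th power of the ratio, while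
    their expectations are known exactly; the two limits must agree. *)
Lemma sojourn_moment r :
  \int[P]_w (sojourn_time B t w / t) ^+ r = arcsine_moment R r.
Proof.
have tau0 n : 0 < t / n.+1%:R by rewrite divr_gt0.
pose K n w := positive_count B (t / n.+1%:R) n.+1 w.
pose g n w : R := (r`! * 'C(K n w, r))%:R / n.+1%:R ^+ r.
have mg n : measurable_fun setT (g n).
  apply: measurable_funM => //.
  rewrite (_ : (fun w => _) = (fun w => r`!%:R * ('C(K n w, r))%:R)).
    apply: measurable_funM => //.
    exact: (measurable_bin_positive_count B_bm (tau0 n) n.+1 r).1.
  by apply/funext => w; rewrite natrM.
have gE n : \int[P]_w g n w =
    arcsine_moment R r * ((r`! * 'C(n.+1, r))%:R / n.+1%:R ^+ r).
  rewrite /Rintegral /g.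
  under eq_integral do rewrite natrM mulrAC EFinM.
  have [mC EC] := measurable_bin_positive_count B_bm (tau0 n) n.+1 r.
  have c0 : 0 <= (r`!%:R : R) / n.+1%:R ^+ r by rewrite divr_ge0 // exprn_ge0.
  have mC' := (measurable_EFinP _ _).2 mC.
  rewrite ge0_integralZl //=.
  by rewrite EC -EFinM /= natrM; ring.
have c1 : \int[P]_w g n w @[n --> \oo] --> \int[P]_w (sojourn_time B t w / t) ^+ r.
  apply: (@bounded_Rintegral_cvg _ _ _ P setT measurableT PT _ _ 1) => //.
  - by apply: measurable_funX; exact: measurable_sojourn_ratio.
  - apply: (@filterS _ _ (ae_filter_ringOfSetsType P)) (cvg_positive_count B_bm t0) => w cw _.
    exact: falling_ratio_cvg.
  - move=> n w _; rewrite ger0_norm; last by rewrite divr_ge0 // exprn_ge0.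
    rewrite ler_pdivrMr ?exprn_gt0 // mul1r -natrX ler_nat.
    rewrite mulnC bin_ffact; apply: leq_trans (ffact_leq_exp _ _) _.
    by case: (r) => // r'; rewrite leq_exp2r // positive_count_le.
have c2 : \int[P]_w g n w @[n --> \oo] --> arcsine_moment R r.
  rewrite (_ : (fun n => _) = (fun n => arcsine_moment R r *
      ((r`! * 'C(n.+1, r))%:R / n.+1%:R ^+ r))); last by apply/funext => n; exact: gE.
  rewrite -[X in _ --> X]mulr1; apply: cvgM; first exact: cvg_cst.
  rewrite -[X in _ --> X](expr1n R r); apply: (@falling_ratio_cvg R (fun n => n.+1)).
  rewrite (_ : (fun n => _) = cst 1); first exact: cvg_cst.
  by apply/funext => n; rewrite divff // pnatr_eq0.
exact: (cvg_unique _ c1 c2).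
Qed.

Lemma sojourn_centered_moment m :
  \int[P]_w (sojourn_time B t w / t - 2^-1) ^+ m =
  (if odd m then 0 else ('C(m, m./2))%:R) / 4 ^+ m.
Proof.
rewrite -centered_arcsine_moment.
have int i : P.-integrable setT (EFin \o (fun w => (sojourn_time B t w / t) ^+ i)).
  apply: (@bounded_integrable _ _ _ P _ measurableT PT _ 1) => //.
    by apply: measurable_funX; exact: measurable_sojourn_ratio.
  move=> w _; have /andP[s0 s1] := sojourn_ratio_bounds B_bm t0 w.
  by rewrite ger0_norm ?exprn_ge0 // exprn_ile1.
transitivity (\int[P]_w (\sum_(i < m.+1)
    ((- 2^-1) ^+ (m - i) *+ 'C(m, i)) * (sojourn_time B t w / t) ^+ i)).
  apply: eq_Rintegral => w _; rewrite addrC exprDn; apply: eq_bigr => i _.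
  by rewrite mulrnAl.
rewrite Rintegral_sum.
  apply: eq_bigr => i _; rewrite (RintegralZl _ measurableT (int i)).
  by rewrite sojourn_moment mulrnAl.
move=> i; apply: (@bounded_integrable _ _ _ P _ measurableT PT _
    `|(- 2^-1) ^+ (m - i) *+ 'C(m, i)|) => //.
  by apply: measurable_funM => //; apply: measurable_funX; exact: measurable_sojourn_ratio.
move=> w _; rewrite normrM ler_piMr //.
have /andP[s0 s1] := sojourn_ratio_bounds B_bm t0 w.
by rewrite ger0_norm ?exprn_ge0 // exprn_ile1.
Qed.

Lemma series_exp_coeff_le (x : R) n : 
  `|series (exp_coeff x) n| <= expR `|x|.
Proof.
apply: (@le_trans _ _ (series (exp_coeff `|x|) n)).
  apply: le_trans (ler_norm_sum _ _ _) _; rewrite /series /=; apply: ler_sum => i _.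
  by rewrite /exp_coeff /= normrM normrX [X in _ * X]ger0_norm.
apply: nondecreasing_cvgn_le; last exact: is_cvg_series_exp_coeff.
apply/nondecreasing_seqP => m; rewrite /series /= big_nat_recr //= lerDl.
exact: exp_coeff_ge0.
Qed.

(** Write [G] for the sojourn time and [z = - (l * t) * (G / t - 2^-1)], so that
    [exp(- l G) = exp(- l t / 2) exp(z)]. In the expansion of [exp(z)] the odd terms integrate to 0,
    and the term of order [2 n] gives [(l t / 4)^(2 n) / n!^2]. *)
Lemma sojourn_laplace (l : R) :
  \int[P]_w expR (- (l * sojourn_time B t w)) =
  expR (- (t / 2 * l)) * bessel_I0 (t / 2 * l).
Proof.
pose y w := sojourn_time B t w / t - 2^-1.
have my : measurable_fun setT y.
  by apply: measurable_funB => //; exact: measurable_sojourn_ratio.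
have y1 w : `|y w| <= 1.
  have /andP[s0 s1] := sojourn_ratio_bounds B_bm t0 w.
  by rewrite ler_norml /y; apply/andP; split; lra.
pose z w := - (l * t) * y w.
have mz : measurable_fun setT z by apply: measurable_funM.
have zM w : `|z w| <= `|l * t|.
  by rewrite /z normrM normrN ler_piMr.
have mexp i : measurable_fun setT (fun w => exp_coeff (z w) i).
  by apply: measurable_funM => //; apply: measurable_funX.
have iexp i : P.-integrable setT (EFin \o (fun w => exp_coeff (z w) i)).
  apply: (@bounded_integrable _ _ _ P _ measurableT PT _ (`|l * t| ^+ i / i`!%:R)) => //.
  move=> w _; rewrite /exp_coeff /= normrM [X in _ * X]ger0_norm //.
  rewrite ler_pM2r ?invr_gt0 ?ltr0n ?fact_gt0 //.
  by rewrite normrX lerXn2r ?nnegrE.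
have c1 : \int[P]_w series (exp_coeff (z w)) n @[n --> \oo] --> \int[P]_w expR (z w).
  apply: (@bounded_Rintegral_cvg _ _ _ P setT measurableT PT _ _ (expR `|l * t|)).
  - by move=> n; rewrite /series /=; apply: measurable_sum.
  - exact: measurableT_comp.
  - by apply: aeW => w _; exact: is_cvg_series_exp_coeff.
  - move=> n w _; apply: le_trans (series_exp_coeff_le _ _) _.
    by rewrite ler_expR.
(* Partial sums of even length: [2 * n] exponential terms, half of them of integral 0, match [n]
   Bessel terms. *)
have c2 : \int[P]_w series (exp_coeff (z w)) (2 * n)%N @[n --> \oo] --> \int[P]_w expR (z w).
  apply: (cvg_comp (fun n => 2 * n)%N _ _ c1); exact: cvg_mulnl.
have E n : \int[P]_w series (exp_coeff (z w)) (2 * n)%N =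
    series (fun k => (t / 2 * l / 2) ^+ (2 * k) * (k`!%:R ^+ 2)^-1) n.
  rewrite /series /=.
  under eq_Rintegral do rewrite big_mkord.
  rewrite Rintegral_sum; last by move=> i; exact: iexp.
  have term i : \int[P]_w exp_coeff (z w) i = (- (l * t)) ^+ i / i`!%:R *
      ((if odd i then 0 else ('C(i, i./2))%:R) / 4 ^+ i).
    rewrite -sojourn_centered_moment -RintegralZl //.
      by apply: eq_Rintegral => w _; rewrite /exp_coeff /= /z exprMn mulrAC.
    apply: (@bounded_integrable _ _ _ P _ measurableT PT _ 1) => //.
      by apply: measurable_funX.
    by move=> w _; rewrite normrX exprn_ile1 ?normr_ge0 ?y1.
  rewrite (eq_bigr _ (fun (i : 'I_(2 * n)) _ => term i)).
  rewrite -(big_mkord xpredT (fun i => (- (l * t)) ^+ i / i`!%:R *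
      ((if odd i then 0 else ('C(i, i./2))%:R) / 4 ^+ i))).
  elim: n => [|n IH]; first by rewrite !big_geq.
  have -> : (2 * n.+1 = (2 * n).+2)%N by lia.
  rewrite !big_nat_recr //= IH -addrA; congr (_ + _).
  rewrite mul2n odd_double /= mul0r mulr0 addr0 doubleK.
  have Hf : ('C(n.*2, n))%:R * (n`!%:R * n`!%:R) = (n.*2)`!%:R :> R.
    have n2 : (n <= n.*2)%N by rewrite -addnn leq_addr.
    have := bin_fact n2; rewrite -[in X in (_ * (_ * X))%N]addnn addnK => <-.
    by rewrite !natrM.
  have n0 : (n`!%:R : R) != 0 by rewrite pnatr_eq0 -lt0n fact_gt0.
  have C0 : (('C(n.*2, n))%:R : R) != 0.
    by rewrite pnatr_eq0 -lt0n bin_gt0 -addnn leq_addr.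
  rewrite -Hf -mul2n !exprM sqrrN.
  have -> : (t / 2 * l / 2) ^+ 2 = (l * t) ^+ 2 / 4 ^+ 2 by field.
  rewrite expr_div_n; field.
    by rewrite mul2n n0 C0 !expf_neq0 // pnatr_eq0.
have -> : bessel_I0 (t / 2 * l) = \int[P]_w expR (z w).
  rewrite /bessel_I0 (_ : series _ = fun n => \int[P]_w series (exp_coeff (z w)) (2 * n)%N).
    exact/cvg_lim.
  by apply/funext => n; rewrite E.
rewrite -RintegralZl //.
  apply: eq_Rintegral => w _; rewrite -expRD; congr expR.
  by rewrite /z /y; field; rewrite gt_eqF.
apply: (@bounded_integrable _ _ _ P _ measurableT PT _ (expR `|l * t|)) => //.
  exact: measurableT_comp.
move=> w _; rewrite ger0_norm ?expR_ge0 // ler_expR.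
exact: le_trans (ler_norm _) _.
Qed.

End ArcsineMoments.

(** * Marginals of the pure birth process *)

Section PartialFractions.
Variable F : fieldType.
Implicit Types (s : seq F) (x y : F).

(** For distinct points this is, up to sign, the divided difference of the constant 1. *)
Definition pf_sum s : F := \sum_(x <- s) (\prod_(y <- s | y != x) (y - x))^-1.

(* [(c - a) / ((a - x) (c - x)) = 1 / (a - x) - 1 / (c - x)]. *)
Let pf_rec a c s : uniq [:: a, c & s] ->
  (c - a) * pf_sum [:: a, c & s] = pf_sum (a :: s) - pf_sum (c :: s).
Proof.
rewrite /= inE => /andP[/norP[ac aS] /andP[cS uS]].
have ca : c - a != 0 by rewrite subr_eq0 eq_sym.
rewrite /pf_sum !big_cons /= !eqxx /= [c == a]eq_sym ac /=.
rewrite mulrDr mulrDr.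
have -> : (c - a) * ((c - a) * \prod_(y <- s | y != a) (y - a))^-1 =
   (\prod_(y <- s | y != a) (y - a))^-1 by rewrite invfM mulVKf.
have -> : (c - a) * ((a - c) * \prod_(y <- s | y != c) (y - c))^-1 =
   - (\prod_(y <- s | y != c) (y - c))^-1.
  by rewrite -[a - c]opprB mulNr invrN invfM mulrN mulVKf.
have -> : (c - a) * \sum_(x <- s) (\prod_(y <- [:: a, c & s] | y != x) (y - x))^-1 =
   \sum_(x <- s) (\prod_(y <- a :: s | y != x) (y - x))^-1 -
   \sum_(x <- s) (\prod_(y <- c :: s | y != x) (y - x))^-1.
  rewrite -sumrB big_distrr /=; apply: eq_big_seq => x xs.
  have ax : a != x by apply: contraNneq aS => ->.
  have cx : c != x by apply: contraNneq cS => ->.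
  rewrite !big_cons ax cx !invfM.
  have ax0 : a - x != 0 by rewrite subr_eq0.
  have cx0 : c - x != 0 by rewrite subr_eq0.
  by move: ((\prod_(y <- s | y != x) _)^-1) => M; field; rewrite ax0 cx0.
by rewrite addrA addrACA opprD.
Qed.

(** The recursion removes one point at a time, and for two points it gives [1 - 1]. *)
Lemma pf_sum0 s : uniq s -> (1 < size s)%N -> pf_sum s = 0.
Proof.
case: s => [//|a [//|c s]] us _.
have ca : c - a != 0.
  by move: us; rewrite /= inE subr_eq0 eq_sym => /andP[/norP[]].
apply: (mulfI ca); rewrite mulr0 pf_rec //.
move: us => /=; rewrite inE => /andP[/norP[_ aS] /andP[cS uS]].
elim: s a c aS cS uS {ca} => [|e s IH] a c aS cS uS.
  by rewrite /pf_sum !big_seq1 !big_cons !big_nil !eqxx /= subrr.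
have zero x : x \notin e :: s -> pf_sum (x :: e :: s) = 0.
  move=> xS; have xe : e - x != 0.
    by move: xS; rewrite inE subr_eq0 eq_sym => /norP[].
  apply: (mulfI xe); rewrite mulr0 pf_rec; last by rewrite cons_uniq xS.
  case/andP: uS => eS us; apply: IH => //.
  by move: xS; rewrite inE => /norP[].
by rewrite !zero // subrr.
Qed.

End PartialFractions.

Section StepFunctions.
Variable R : realType.

(** Let [c] be the supremum of the points up to which [f] stays at or above [f a]. The left limit
    and the upward jump carry the bound to [c], and right continuity carries it past [c] unless
    [c = b]. *)
Lemma jump_up_nondecreasing (f : R -> nat) :
  (forall t, 0 <= t -> \forall s \near t^'+, f s = f t) ->
  (forall t, 0 < t -> exists k : nat,
    (\forall s \near t^'-, f s = k) /\ (f t = k \/ f t = k.+1)) ->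
  forall a b, 0 <= a -> a <= b -> (f a <= f b)%N.
Proof.
move=> rc lc a b a0 ab.
pose E := [set x | a <= x <= b /\ forall y, a <= y <= x -> (f a <= f y)%N].
have Ea : E a.
  by split=> [|y /andP[ay ya]]; [rewrite lexx|rewrite (_ : y = a) //; apply/le_anti; rewrite ya].
have hE : has_sup E by split; [exists a|exists b => x [/andP[_]]].
pose c := sup E.
have ac : a <= c by apply: ub_le_sup => //; exact: hE.2.
have cb : c <= b by apply: ge_sup => [|x [/andP[_]]] //; exists a.
have below y : a <= y -> y < c -> (f a <= f y)%N.
  move=> ay yc; have [x Ex yx] := sup_gt hE.1 yc.
  by case: Ex => _; apply; rewrite ay ltW.
have Ec : (f a <= f c)%N.
  have [<- //|ac'] := eqVneq a c.
  have {}ac' : a < c by rewrite lt_neqAle ac' ac.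
  have [k [nk fc]] := lc c (le_lt_trans a0 ac').
  have [y [ay yc fy]] : exists y, [/\ a <= y, y < c & f y = k].
    have : \forall y \near c^'-, [/\ a <= y, y < c & f y = k].
      near=> y; split.
      + by near: y; apply: nbhs_left_ge.
      + by near: y; apply: nbhs_left_lt.
      + by near: y.
    exact: filter_ex.
  have := below y ay yc; rewrite fy.
  by case: fc => ->; lia.
have [<-//|cb'] := eqVneq c b.
have {}cb' : c < b by rewrite lt_neqAle cb' cb.
have := rc c (le_trans a0 ac); rewrite near_withinE => /nbhs_ballP[e /= e0 He].
pose x := Num.min b (c + e / 2).
have cx : c < x by rewrite lt_min cb' ltrDl divr_gt0.
suff Ex : E x by have := ub_le_sup hE.2 Ex; rewrite leNgt cx.
split; first by rewrite ge_min lexx (le_trans ac (ltW cx)).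
move=> y /andP[ay yx].
have [yc|cy] := ltP y c; first exact: below.
have [->//|yc'] := eqVneq y c.
have cy' : c < y by rewrite lt_neqAle eq_sym yc'.
rewrite (He y) //.
rewrite /ball /= distrC ger0_norm ?subr_ge0 //.
have : x <= c + e / 2 by rewrite ge_min lexx orbT.
lra.
Unshelve. all: by end_near.
Qed.

(* A one-step error that is [o(h)] uniformly in time adds up to [o(1)] over the [n]
   steps of length [s / n], so no differentiability of [D] is needed. *)
Lemma euler_unique (D eta : R -> R) (l s : R) : 0 <= l -> 0 < s -> D 0 = 0 ->
  (forall x h, 0 <= x -> 0 < h -> `|D (x + h) - (1 - l * h) * D x| <= eta h) ->
  eta (s / n.+1%:R) / (s / n.+1%:R) @[n --> \oo] --> 0 -> D s = 0.
Proof.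
move=> l0 s0 D0 HD ceta.
pose h n := s / n.+1%:R.
have h0 n : 0 < h n by rewrite divr_gt0.
have bound : \forall n \near \oo, `|D s| <= s * (eta (h n) / h n).
  have ch : (fun n => l * h n) @ \oo --> 0.
    rewrite -(mulr0 l); apply: cvgM; first exact: cvg_cst.
    rewrite -(mulr0 s); apply: cvgM; [exact: cvg_cst|exact: cvg_harmonic].
  (* Once [l * h n < 1], the factor [1 - l * h n] lies in [[0, 1]] and earlier errors are not
     amplified. *)
  move/cvgrPdist_lt : ch => /(_ 1 ltr01); apply: filterS => n.
  rewrite sub0r normrN ger0_norm; last by rewrite mulr_ge0 // ltW.
  move=> lh1.
  have step j : `|D (j%:R * h n)| <= j%:R * eta (h n).
    elim: j => [|j IH]; first by rewrite !mul0r D0 normr0.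
    rewrite -natr1 !mulrDl !mul1r.
    have jh : 0 <= j%:R * h n by rewrite mulr_ge0 // ltW.
    have := HD _ _ jh (h0 n); set a := D (_ + _); set b := D _ in IH *.
    move=> Hab; have -> : a = (a - (1 - l * h n) * b) + (1 - l * h n) * b by rewrite subrK.
    apply: le_trans (ler_normD _ _) _; rewrite addrC; apply: lerD => //.
    apply: le_trans IH; rewrite normrM ler_piMl // ger0_norm; last by rewrite subr_ge0 ltW.
    by rewrite gerBl mulr_ge0 // ltW.
  have := step n.+1.
  have -> : n.+1%:R * h n = s by rewrite mulrC divfK.
  move=> H; apply: le_trans H _.
  rewrite le_eqVlt; apply/orP; left; apply/eqP; rewrite /h.
  by rewrite invf_div mulrCA [s * (_ / s)]mulrC divfK ?gt_eqF // mulrC.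
have c0 : s * (eta (h n) / h n) @[n --> \oo] --> 0.
  by rewrite -(mulr0 s); apply: cvgM ceta; exact: cvg_cst.
apply/eqP; rewrite -normr_le0.
exact: (cvgr_to_ge c0 bound).
Qed.

End StepFunctions.

Section ExplicitMarginals.
Context (R : realType) (lam : nat -> R).
Hypothesis lam_gt0 : forall k, (1 <= k)%N -> 0 < lam k.
Hypothesis lam_distinct : forall j k, (1 <= j)%N -> (1 <= k)%N -> j <> k ->
  lam j <> lam k.

Definition pb_weight (k m : nat) : R :=
  (\prod_(1 <= j < k) lam j) / \prod_(1 <= l < k.+1 | l != m) (lam l - lam m).

Definition pb_marginal (k : nat) (s : R) : R :=
  \sum_(1 <= m < k.+1) pb_weight k m * expR (- (lam m * s)).

Let lam_sub m k : (1 <= m)%N -> (m < k)%N -> lam k - lam m != 0.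
Proof.
move=> m1 mk; rewrite subr_eq0; apply/eqP; apply: lam_distinct => //; lia.
Qed.

(** This is the forward equation [q' = lam k * q_k - lam k.+1 * q] for the marginal [q] of state
    [k.+1], read off at the exponential of rate [lam m]. *)
Lemma pb_weightS k m : (1 <= m)%N -> (m <= k)%N -> 
  (lam k.+1 - lam m) * pb_weight k.+1 m = lam k * pb_weight k m.
Proof.
move=> m1 mk; rewrite /pb_weight.
have -> : \prod_(1 <= j < k.+1) lam j = (\prod_(1 <= j < k) lam j) * lam k.
  by rewrite big_nat_recr //=; lia.
have -> : \prod_(1 <= l < k.+2 | l != m) (lam l - lam m) =
    (\prod_(1 <= l < k.+1 | l != m) (lam l - lam m)) * (lam k.+1 - lam m).
  by rewrite big_mkcond big_nat_recr //= -big_mkcond /= (_ : k.+1 != m) //; lia.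
have := lam_sub m1 (mk : (m < k.+1)%N); move: (lam k.+1 - lam m) => z z0.
by rewrite invfM; move: ((\prod_(1 <= l < k.+1 | l != m) _)^-1) => M; field.
Qed.

Lemma pb_weight11 : pb_weight 1 1 = 1.
Proof.
by rewrite /pb_weight big_geq // big_mkcond big_nat1 /= invr1 mulr1.
Qed.

(** Beyond state 1 the weights add up to a multiple of [pf_sum] at distinct rates, which is 0. *)
Lemma pb_marginal0 k : (1 <= k)%N -> pb_marginal k 0 = (k == 1%N)%:R.
Proof.
move=> k1; rewrite /pb_marginal.
under eq_bigr do rewrite mulr0 oppr0 expR0 mulr1.
case: k k1 => [//|[_|k _]]; first by rewrite big_nat1 pb_weight11.
rewrite -big_distrr /=.
have inj : {in index_iota 1 k.+3 &, injective lam}.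
  move=> i j; rewrite !mem_index_iota => /andP[i1 _] /andP[j1 _] ij.
  by apply: contrapT => nij; exact: lam_distinct ij.
have -> : \sum_(1 <= m < k.+3) (\prod_(1 <= l < k.+3 | l != m) (lam l - lam m))^-1 =
    pf_sum (map lam (index_iota 1 k.+3)).
  rewrite /pf_sum big_map; apply: eq_big_seq => m mi; congr (_^-1).
  rewrite big_map big_seq_cond [RHS]big_seq_cond; apply: eq_bigl => l.
  case li : (l \in _) => //=.
  by rewrite (inj_in_eq inj).
rewrite pf_sum0 ?mulr0 //.
by rewrite map_inj_in_uniq // iota_uniq.
Qed.

(** Both bounds come from [1 + y <= exp y], at [y = - x] and at [y = x]. *)
Lemma expR_second_order (x : R) : 0 <= x -> `|expR (- x) - 1 + x| <= x ^+ 2.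
Proof.
move=> x0; rewrite ger0_norm; last by have := expR_ge1Dx (- x); lra.
have x1 : 0 < 1 + x by lra.
have := expR_ge1Dx x; rewrite -[X in _ <= X]invrK -expRN => h.
have h2 : expR (- x) <= (1 + x)^-1.
  by rewrite -[leLHS]invrK lef_pV2 ?posrE // invr_gt0 expR_gt0.
have h3 : (1 + x)^-1 <= 1 - x + x ^+ 2.
  rewrite -[leLHS]mul1r ler_pdivrMr //.
  have -> : (1 - x + x ^+ 2) * (1 + x) = 1 + x ^+ 3 by ring.
  by rewrite lerDl exprn_ge0.
lra.
Qed.

(** A bound for the second derivative of [pb_marginal k] on nonnegative times when the rates are
    positive. *)
Definition pb_curvature k : R := \sum_(1 <= m < k.+1) `|pb_weight k m| * lam m ^+ 2.

Lemma pb_marginal_euler k s h : 0 <= s -> 0 < h ->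
  `|pb_marginal k.+1 (s + h) - (1 - lam k.+1 * h) * pb_marginal k.+1 s -
    h * (lam k * pb_marginal k s)| <= pb_curvature k.+1 * h ^+ 2.
Proof.
move=> s0 h0.
have bnd m : (1 <= m)%N -> forall w : R,
  `|w * expR (- (lam m * s)) * (expR (- (lam m * h)) - 1 + lam m * h)| <=
   `|w| * lam m ^+ 2 * h ^+ 2.
  move=> m1 w; rewrite normrM normrM -mulrA -[leRHS]mulrA; apply: ler_wpM2l => //.
  have lm := ltW (lam_gt0 m1).
  have lh : 0 <= lam m * h by rewrite mulr_ge0 // ltW.
  rewrite -exprMn; apply: le_trans (expR_second_order lh).
  rewrite ler_piMl // ger0_norm ?expR_ge0 // -[leRHS]expR0 ler_expR oppr_le0.
  by rewrite mulr_ge0.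
have expD m : expR (- (lam m * (s + h))) = expR (- (lam m * s)) * expR (- (lam m * h)).
  by rewrite -expRD mulrDr opprD.
have -> : pb_marginal k.+1 (s + h) - (1 - lam k.+1 * h) * pb_marginal k.+1 s -
    h * (lam k * pb_marginal k s) = \sum_(1 <= m < k.+2)
   pb_weight k.+1 m * expR (- (lam m * s)) * (expR (- (lam m * h)) - 1 + lam m * h).
  (* The term [m = k.+1] is split off, having no counterpart in [pb_marginal k]. *)
  rewrite /pb_marginal big_nat_recr //= [X in _ - (_ * X) - _]big_nat_recr //=.
  rewrite [RHS]big_nat_recr //= expD.
  have -> : \sum_(1 <= m < k.+1) pb_weight k.+1 m * expR (- (lam m * (s + h))) =
      \sum_(1 <= m < k.+1) pb_weight k.+1 m * expR (- (lam m * s)) *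
         (expR (- (lam m * h)) - 1 + lam m * h) +
      (1 - lam k.+1 * h) * \sum_(1 <= m < k.+1) pb_weight k.+1 m * expR (- (lam m * s)) +
      h * (lam k * \sum_(1 <= m < k.+1) pb_weight k m * expR (- (lam m * s))).
    rewrite !big_distrr -!big_split /= !big_nat; apply: eq_bigr => m /andP[m1 mk].
    have := pb_weightS m1 (mk : (m <= k)%N).
    rewrite [lam k * (_ * _)]mulrA => <-.
    by rewrite expD; ring.
  by ring.
apply: le_trans (ler_norm_sum _ _ _) _.
rewrite /pb_curvature big_distrl /= !big_nat; apply: ler_sum => m /andP[m1 _].
exact: bnd.
Qed.

End ExplicitMarginals.

Section BirthMarginals.
Context (R : realType) d (T : measurableType d) (P : probability T R).
Variables (lam : nat -> R) (N : R -> {RV P >-> nat}).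
Hypothesis N_birth : pure_birth_process lam N.
Hypothesis lam_gt0 : forall k, (1 <= k)%N -> 0 < lam k.
Hypothesis lam_distinct : forall j k, (1 <= j)%N -> (1 <= k)%N -> j <> k ->
  lam j <> lam k.

Definition state_prob (k : nat) (s : R) : R := fine (P [set w | N s w = k]).

Let joint (i k : nat) (s h : R) : R :=
  fine (P ([set w | N s w = i] `&` [set w | N (s + h) w = k])).

Lemma measurable_state s k : measurable [set w | N s w = k].
Proof.
have : measurable_fun setT (N s) by exact: measurable_funP.
by move=> /(_ measurableT [set k] Logic.I); rewrite setTI.
Qed.

#[local] Hint Resolve measurable_state : core.

Lemma state_prob_ge0 k s : 0 <= state_prob k s.
Proof. exact: fine_ge0. Qed.

Lemma state_prob_le1 k s : state_prob k s <= 1.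
Proof.
by rewrite -lee_fin /state_prob fineK ?fin_num_measure // probability_le1.
Qed.

Lemma state_prob0 s : 0 <= s -> state_prob 0 s = 0.
Proof.
move=> s0; rewrite /state_prob (_ : [set w | _] = set0) ?measure0 //.
by apply/seteqP; split=> // w /= Nw; have := pb_states N_birth w s0; rewrite Nw.
Qed.

Lemma state_prob_init k : state_prob k 0 = (k == 1%N)%:R.
Proof.
rewrite /state_prob; have [->|k1] := eqVneq k 1%N.
  rewrite -[RHS]/(fine 1%:E); congr fine.
  have /(measure_negligible _) n0 := pb_start N_birth.
  rewrite -[[set w | _]]setCK probability_setC; last exact: measurableC.
  by rewrite (n0 (measurableC (measurable_state 0 1))) sube0.
rewrite -[RHS]/(fine 0%:E); congr fine.
apply: measure_negligible => //.
apply: negligibleS (pb_start N_birth) => w /= -> h.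
by move: k1; rewrite h eqxx.
Qed.

Lemma paths_nondecreasing :
  {ae P, forall w a b, 0 <= a -> a <= b -> (N a w <= N b w)%N}.
Proof.
apply: (@filterS _ _ (ae_filter_ringOfSetsType P)) (pb_jumps N_birth) => w jumps a b a0 ab.
apply: (@jump_up_nondecreasing R (fun s => N s w)) => //.
by move=> t t0; exact: pb_rcont N_birth _ _ t0.
Qed.

(** Almost every path is nondecreasing, so the state at time [s] cannot exceed [k]; this keeps the
    sum finite. *)
Lemma state_prob_sum k s h : 0 <= s -> 0 < h ->
  state_prob k (s + h) = \sum_(i < k.+1) joint i k s h.
Proof.
move=> s0 h0.
pose A (i : 'I_k.+1) := [set w | N s w = i] `&` [set w | N (s + h) w = k].
have mA i : measurable (A i) by apply: measurableI.
pose U := \big[setU/set0]_(i < k.+1) A i.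
have mU : measurable U by apply: bigsetU_measurable => i _.
have PU : P U = (\sum_(i < k.+1) P (A i))%E.
  apply: measure_bigsetU_ord => //; apply/trivIsetP => i j _ _ ij.
  apply/seteqP; split=> // w [[/= h1 _] [/= h2 _]].
  by move/eqP: ij; apply; apply: val_inj; rewrite /= -h1.
have -> : state_prob k (s + h) = fine (P U).
  congr fine.
  rewrite (_ : [set w | _] = U `|` ([set w | N (s + h) w = k] `\` U)); last first.
    apply/seteqP; split=> [w Nk|w [|[]//]].
      by have [Uw|nUw] := pselect (U w); [left|right].
    by rewrite /U -bigcup_mkord_ord => -[i _ []].
  rewrite measureU0 //; first exact: measurableD.
  apply: measure_negligible; first exact: measurableD.
  apply: negligibleS paths_nondecreasing => w [/= Nk nU] mono.
  apply: nU; rewrite /U.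
  have le : (N s w < k.+1)%N.
    by rewrite ltnS -Nk mono // lerDl ltW.
  by rewrite (bigD1 (Ordinal le)) //=; left.
rewrite PU -sum_fine // => i _; first by rewrite fin_num_measure.
Qed.

Lemma joint_transition p : markov_chain p N -> forall i k s h, 0 <= s -> 0 < h ->
  joint i k s h = state_prob i s * p h i k.
Proof.
move=> mk i k s h s0 h0.
(* On a null past [markov_chain] says nothing, but both sides are 0. *)
have [past0|past0] := eqVneq (P [set w | N s w = i]) 0%E.
  rewrite /state_prob past0 /= mul0r -[RHS]/(fine 0%:E); congr fine.
  apply/eqP; rewrite -measure_le0 -past0 le_measure ?inE //; first exact: measurableI.
pose u (j : nat) := s + j%:R * h.
pose x (j : nat) := if j is 0%N then i else k.
have u0 : 0 <= u 0%N by rewrite /u mul0r addr0.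
have ulr j : (j <= 0)%N -> u j < u j.+1.
  by move=> _; rewrite /u ltrD2l ltr_pM2r // ltr_nat.
have pastE : [set w | forall j, (j <= 0)%N -> N (u j) w = x j] = [set w | N s w = i].
  apply/seteqP; split=> w /=; first by move=> /(_ 0%N isT); rewrite /u mul0r addr0.
  by move=> Ns j; rewrite leqn0 => /eqP ->; rewrite /u mul0r addr0.
have := mk 0%N u x u0 ulr; rewrite /= pastE => /(_ past0).
rewrite /u /= mul0r addr0 mul1r addrAC subrr add0r => <-.
rewrite /cond_prob -/(state_prob i s) mulrC divfK; first by rewrite setIC.
by rewrite /state_prob -(eqe _ 0) fineK // fin_num_measure.
Qed.

Lemma joint_ge0 i k s h : 0 <= joint i k s h.
Proof. exact: fine_ge0. Qed.

(** Three disjoint events inside [N s = i]: a jump to another state [k] has at most the probability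
    left over by staying and by stepping up once. *)
Lemma joint3_le i k s h : k != i -> k != i.+1 ->
  joint i k s h + joint i i s h + joint i i.+1 s h <= state_prob i s.
Proof.
move=> ki ki1; rewrite -lee_fin !EFinD /joint /state_prob !fineK ?fin_num_measure //;
  try exact: measurableI.
have disj a b : a <> b ->
    [set w | N s w = i] `&` [set w | N (s + h) w = a] `&`
    ([set w | N s w = i] `&` [set w | N (s + h) w = b]) = set0.
  by move=> ab; apply/seteqP; split=> // w [[/= _ h1] [_ h2]]; apply: ab; rewrite -h1.
have ii1 : i <> i.+1 by lia.
rewrite -measureU; try exact: measurableI; last by apply: disj; exact/eqP.
rewrite -measureU; try exact: measurableI; last first.
- by rewrite setIUl !disj ?setU0 //; exact/eqP.
- by apply: measurableU; exact: measurableI.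
apply: le_measure; rewrite ?inE //.
- by apply: measurableU; [apply: measurableU|]; exact: measurableI.
- by move=> w /= [[[]|[]]|[]].
Qed.

(* Both [p h i i.+1] and [1 - p h i i] are within this error of [lam i * h], so it also
   bounds the probability of leaving [i] for a state other than [i.+1]. *)
Definition rate_error (p : R -> nat -> nat -> R) (k : nat) (h : R) : R :=
  \sum_(1 <= i < k.+1) (`|p h i i.+1 - lam i * h| + `|1 - p h i i - lam i * h|).

(** Split by the state at time [s]: [k] and [k.+1] give the main terms, and each lower state
    contributes a jump of at least 2, bounded through [joint3_le]. State probabilities are at most
    1, so the error is uniform in [s]. *)
Lemma state_prob_euler p : markov_chain p N -> forall k s h, 0 <= s -> 0 < h ->
  `|state_prob k.+1 (s + h) - (1 - lam k.+1 * h) * state_prob k.+1 s -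
    h * (lam k * state_prob k s)| <= rate_error p k.+1 h.
Proof.
move=> mk k s h s0 h0.
rewrite state_prob_sum // !big_ord_recr /= !(joint_transition mk) //.
set q := state_prob k s; set q' := state_prob k.+1 s; set S := \sum_(i < k) _.
have -> : S + q * p h k k.+1 + q' * p h k.+1 k.+1 - (1 - lam k.+1 * h) * q' -
    h * (lam k * q) = S + q * (p h k k.+1 - lam k * h) +
    - (q' * (1 - p h k.+1 k.+1 - lam k.+1 * h)) by ring.
have q1 : `|q'| <= 1 by rewrite ger0_norm ?state_prob_ge0 // state_prob_le1.
have last : `|- (q' * (1 - p h k.+1 k.+1 - lam k.+1 * h))| <=
    `|p h k.+1 k.+2 - lam k.+1 * h| + `|1 - p h k.+1 k.+1 - lam k.+1 * h|.
  by rewrite normrN normrM (le_trans (ler_piMl _ q1)) // lerDr.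
rewrite /rate_error big_nat_recr //=.
apply: le_trans (ler_normD _ _) _; apply: lerD => //.
have S0 : 0 <= S by apply: sumr_ge0 => i _; exact: joint_ge0.
(* For [k = 0] the sum [S] is empty and the predecessor, state 0, is never occupied. *)
case: k => [|k] in q q' S q1 last S0 *.
  by rewrite /S big_ord0 add0r /q state_prob0 // mul0r normr0 big_geq.
rewrite big_nat_recr //=.
apply: le_trans (ler_normD _ _) _; apply: lerD; last first.
  rewrite normrM; apply: (@le_trans _ _ `|p h k.+1 k.+2 - lam k.+1 * h|); last by rewrite lerDl.
  by rewrite ler_piMl // ger0_norm ?state_prob_ge0 // state_prob_le1.
rewrite ger0_norm // /S big_ord_recl /=.
have -> : joint 0 k.+2 s h = 0 by rewrite (joint_transition mk) // state_prob0 // mul0r.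
rewrite add0r big_add1 /= big_mkord; apply: ler_sum => i _.
rewrite /bump /= add1n; have ik := ltn_ord i; set j := i.+1.
have := @joint3_le j k.+2 s h; rewrite !(joint_transition mk) //.
move=> /(_ (_ : k.+2 != j)) H.
have {}H : state_prob j s * p h j k.+2 <= state_prob j s * (1 - p h j j - p h j j.+1).
  have : state_prob j s * p h j k.+2 + state_prob j s * p h j j +
     state_prob j s * p h j j.+1 <= state_prob j s by apply: H; rewrite /j; lia.
  by rewrite !mulrBr mulr1; lra.
apply: le_trans H _.
apply: (@le_trans _ _ `|1 - p h j j - p h j j.+1|).
  apply: le_trans (ler_norm _) _; rewrite normrM ler_piMl //.
  by rewrite ger0_norm ?state_prob_ge0 // state_prob_le1.
(* The rate term [lam j * h] cancels, leaving the two deviations counted in [rate_error]. *)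
rewrite (_ : 1 - _ - _ = - (p h j j.+1 - lam j * h) + (1 - p h j j - lam j * h)); last by ring.
by apply: le_trans (ler_normD _ _) _; rewrite normrN.
Qed.

Lemma cvg_rate_error p : (forall k, (1 <= k)%N ->
      (p h k k.+1 / h @[h --> 0^'+] --> lam k) /\
      ((1 - p h k k) / h @[h --> 0^'+] --> lam k)) ->
  forall k (s : R), 0 < s ->
  rate_error p k (s / n.+1%:R) / (s / n.+1%:R) @[n --> \oo] --> 0.
Proof.
move=> rates k s s0; rewrite /rate_error.
have h0 n : 0 < s / n.+1%:R by rewrite divr_gt0.
have ch : s / n.+1%:R @[n --> \oo] --> 0.
  by rewrite -(mulr0 s); apply: cvgM; [exact: cvg_cst|exact: cvg_harmonic].
elim: k => [|k IH].
  rewrite (_ : (fun n => _) = cst 0); first exact: cvg_cst.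
  by apply/funext => n; rewrite big_geq // mul0r.
have [/cvg_at_rightP c1 /cvg_at_rightP c2] := rates k.+1 isT.
have {}c1 := c1 _ (conj h0 ch); have {}c2 := c2 _ (conj h0 ch).
rewrite (_ : (fun n => _) = (fun n =>
  (\sum_(1 <= i < k.+1) (`|p (s / n.+1%:R) i i.+1 - lam i * (s / n.+1%:R)| +
    `|1 - p (s / n.+1%:R) i i - lam i * (s / n.+1%:R)|)) / (s / n.+1%:R) +
  (`|p (s / n.+1%:R) k.+1 k.+2 / (s / n.+1%:R) - lam k.+1| +
   `|(1 - p (s / n.+1%:R) k.+1 k.+1) / (s / n.+1%:R) - lam k.+1|))); last first.
  apply/funext => n; rewrite big_nat_recr //= mulrDl; congr (_ + _).
  move: (h0 n); move: (s / n.+1%:R) => h hpos.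
  rewrite mulrDl; have normdiv x : `|x| / h = `|x / h|.
    by rewrite normrM normfV (gtr0_norm hpos).
  by rewrite !normdiv !mulrBl !mulfK ?gt_eqF.
rewrite -[X in _ --> X]addr0; apply: cvgD => //.
rewrite -[X in _ --> X]addr0; apply: cvgD.
  rewrite -[X in _ --> X](normr0 R) -(subrr (lam k.+1)).
  by apply: cvg_norm; apply: cvgB => //; exact: cvg_cst.
rewrite -[X in _ --> X](normr0 R) -(subrr (lam k.+1)).
by apply: cvg_norm; apply: cvgB => //; exact: cvg_cst.
Qed.

(** By induction on the state, the inflow terms of the two Euler estimates coincide, so the
    difference obeys the homogeneous recursion of [euler_unique] and starts at 0. *)
Lemma pure_birth_law k s : (1 <= k)%N -> 0 <= s -> state_prob k s = pb_marginal lam k s.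
Proof.
have [p mk rates] := pb_markov N_birth.
move=> k1 s0; have [<-|s0'] := eqVneq 0 s.
  by rewrite state_prob_init pb_marginal0.
have {}s0 : 0 < s by rewrite lt_neqAle s0' s0.
(* The claim is extended to [j = 0], where both sides are 0, to start the induction. *)
suff H j x : 0 <= x -> state_prob j x = pb_marginal lam j x by apply: H; exact: ltW.
elim: j x => [|j IH] x x0.
  by rewrite state_prob0 // /pb_marginal big_geq.
have [<-|x0'] := eqVneq 0 x.
  by rewrite state_prob_init pb_marginal0.
have {x0'}x0 : 0 < x by rewrite lt_neqAle x0' x0.
apply/eqP; rewrite -subr_eq0; apply/eqP.
pose D y := state_prob j.+1 y - pb_marginal lam j.+1 y.
pose eta h := rate_error p j.+1 h + pb_curvature lam j.+1 * h ^+ 2.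
apply: (@euler_unique R D eta (lam j.+1) x) => //.
- exact/ltW/lam_gt0.
- by rewrite /D state_prob_init pb_marginal0 // subrr.
- move=> y h y0 h0.
  have e1 := state_prob_euler mk j y0 h0.
  have e2 := pb_marginal_euler lam_gt0 lam_distinct j y0 h0.
  rewrite IH // in e1.
  apply: le_trans (lerD e1 e2); apply: le_trans (ler_normB _ _).
  rewrite le_eqVlt; apply/orP; left; apply/eqP; congr (`|_|).
  by rewrite /D; ring.
- rewrite -[X in _ --> X]addr0.
  rewrite (_ : (fun n => _) = (fun n => rate_error p j.+1 (x / n.+1%:R) / (x / n.+1%:R) +
     pb_curvature lam j.+1 * (x / n.+1%:R))).
    apply: cvgD; first exact: cvg_rate_error.
    rewrite -(mulr0 (pb_curvature lam j.+1)); apply: cvgM; first exact: cvg_cst.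
    by rewrite -(mulr0 x); apply: cvgM; [exact: cvg_cst|exact: cvg_harmonic].
  apply/funext => n; rewrite /eta mulrDl expr2 mulrA mulfK //.
  by rewrite gt_eqF // divr_gt0.
Qed.

End BirthMarginals.

(** * The birth process at the sojourn time *)

Section RandomTime.
Context (R : realType) d (T : measurableType d) (P : probability T R).
Variables (lam : nat -> R) (N : R -> {RV P >-> nat}) (B : R -> {RV P >-> R}).
Hypothesis N_birth : pure_birth_process lam N.
Hypothesis lam_gt0 : forall k, (1 <= k)%N -> 0 < lam k.
Hypothesis lam_distinct : forall j k, (1 <= j)%N -> (1 <= k)%N -> j <> k ->
  lam j <> lam k.
Hypothesis B_bm : brownian_motion B.
Hypothesis NB_indep : independent_processes N B.

(** Independence concerns generated sigma-algebras, so measurability on [T] is not enough: the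
    occupation time is taken on the space carrying only the sigma-algebra of [B]. *)
Lemma sojourn_time_sigma (t : R) (A : set R) : measurable A ->
  sigma_process B (sojourn_time B t @^-1` A).
Proof.
move=> mA.
pose gen := [set E : set T | exists s (C : set R), [/\ 0 <= s, measurable C & E = B s @^-1` C]].
pose X (s : R) (w : g_sigma_algebraType gen) : R := B s w.
have mX s : 0 <= s -> measurable_fun setT (X s).
  move=> s0 _ C mC; rewrite setTI; apply: sub_sigma_algebra.
  by exists s, C.
have := measurable_time_above mX (bm_cont B_bm) t.
by move=> /(_ measurableT A mA); rewrite setTI.
Qed.

(** On a cell the grid time is the constant [j.+1%:R / n.+1%:R], so [N] is observed there at a
    deterministic time. *)
Let cell (t : R) n j := [set w | Num.truncn (sojourn_time B t w * n.+1%:R) = j].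

Let cell_sigma t n j : sigma_process B (cell t n j).
Proof. exact: sojourn_time_sigma (measurable_truncn_eq _ _). Qed.

Let measurable_cell t n j : measurable (cell t n j).
Proof.
apply: smallest_sub (@cell_sigma t n j); first exact: sigma_algebra_measurable.
by move=> _ [s [C [s0 mC ->]]]; exact: measurable_sfunP.
Qed.

Let state_at_grid (t : R) k n := [set w | N (right_grid n (sojourn_time B t w)) w = k].

Let state_at_gridE t k n : state_at_grid t k n =
  \bigcup_j (cell t n j `&` [set w | N (j.+1%:R / n.+1%:R) w = k]).
Proof.
apply/seteqP; split=> [w /= h|w [j _ [/= <- //]]].
by exists (Num.truncn (sojourn_time B t w * n.+1%:R)).
Qed.

Let measurable_state_at_grid t k n : measurable (state_at_grid t k n).
Proof.
rewrite state_at_gridE; apply: bigcupT_measurable => j.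
by apply: measurableI; [exact: measurable_cell|exact: measurable_state].
Qed.

(** Both sides are the sum over cells of [Q j] times the probability of the cell: the left by
    independence and [pure_birth_law], the right because the integrand is constant on each cell. *)
Let prob_state_at_grid t k n : 0 < t -> (1 <= k)%N ->
  \int[P]_w (\1_(state_at_grid t k n) w) =
  \int[P]_w pb_marginal lam k (right_grid n (sojourn_time B t w)).
Proof.
move=> t0 k1.
(* The sojourn time is at most [t], so only finitely many cells are met. *)
pose J := (Num.truncn (t * n.+1%:R)).+1.
pose Q j := pb_marginal lam k (j.+1%:R / n.+1%:R).
have Jbound w : (Num.truncn (sojourn_time B t w * n.+1%:R) < J)%N.
  rewrite ltnS; apply: le_truncn; rewrite ler_pM2r //.
  by have /andP[] := sojourn_time_bounds B_bm t0 w.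
have pick w (F : nat -> R) :
    \sum_(j < J) F j * \1_(cell t n j) w = F (Num.truncn (sojourn_time B t w * n.+1%:R)).
  rewrite (bigD1 (Ordinal (Jbound w))) //= big1 ?addr0.
    by rewrite indicE mem_set ?mulr1.
  move=> j nj; rewrite indicE memNset ?mulr0 //= => h.
  by move: nj; rewrite -val_eqE /= h eqxx.
have PT : (P setT < +oo)%E by rewrite probability_setT ltry.
have int (E : set T) c : measurable E -> P.-integrable setT (EFin \o (fun w => c * \1_E w)).
  move=> mE; apply: (@bounded_integrable _ _ _ P _ measurableT PT _ `|c|).
    by apply: measurable_funM => //; exact: measurable_indic.
  by move=> w _; rewrite normrM ler_piMr // ger0_norm // indic_le1.
have intE (E : set T) c : measurable E -> \int[P]_w (c * \1_E w) = c * fine (P E).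
  move=> mE; rewrite RintegralZl //; last first.
    apply: (@bounded_integrable _ _ _ P _ measurableT PT _ 1); first exact: measurable_indic.
    by move=> w _; rewrite ger0_norm // indic_le1.
  by rewrite /Rintegral integral_indic // setIT.
transitivity (\sum_(j < J) Q j * fine (P (cell t n j))); last first.
  rewrite (@eq_Rintegral _ _ _ P setT (fun w => \sum_(j < J) Q j * \1_(cell t n j) w)).
    by rewrite Rintegral_sum => [|j]; [apply: eq_bigr => j _; rewrite intE|exact: int].
  by move=> w _; rewrite (pick w Q).
pose C j := cell t n j `&` [set w | N (j.+1%:R / n.+1%:R) w = k].
have mC j : measurable (C j).
  by apply: measurableI; [exact: measurable_cell|exact: measurable_state].
rewrite (@eq_Rintegral _ _ _ P setT (fun w => \sum_(j < J) 1 * \1_(C j) w)).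
  rewrite Rintegral_sum => [|j]; last exact: int.
  apply: eq_bigr => j _; rewrite intE // mul1r /C setIC.
  have sN : sigma_process N [set w | N (j.+1%:R / n.+1%:R) w = k].
    apply: sub_sigma_algebra; exists (j.+1%:R / n.+1%:R), [set k].
    by split => //; rewrite divr_ge0.
  have mN := measurable_state N (j.+1%:R / n.+1%:R) k.
  rewrite (NB_indep sN (@cell_sigma t n j)) fineM ?fin_num_measure //.
  congr (_ * _).
  by rewrite -[LHS]/(state_prob N k _) (pure_birth_law N_birth) // divr_ge0.
move=> w _.
rewrite (eq_bigr (fun j : 'I_J => (N (j.+1%:R / n.+1%:R) w == k)%:R * \1_(cell t n j) w)).
  rewrite (pick w (fun j => (N (j.+1%:R / n.+1%:R) w == k)%:R)) indicE.
  congr (nat_of_bool _)%:R.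
  by apply/idP/idP; rewrite inE => /eqP.
move=> j _; rewrite mul1r !indicE -natrM mulnb; congr (nat_of_bool _)%:R.
apply/idP/andP => [/set_mem[h1 h2]|[/eqP h1 /set_mem h2]].
  by split; [exact/eqP|exact/mem_set].
by apply/mem_set; split.
Qed.

Lemma continuous_pb_marginal k : continuous (pb_marginal lam k).
Proof.
move=> s; rewrite /pb_marginal; elim: (index_iota 1 k.+1) => [|m r IH].
  rewrite (_ : (fun s => _) = cst 0); first exact: cvg_cst.
  by apply/funext => x; rewrite big_nil.
rewrite (_ : (fun s => _) = (fun s => pb_weight lam k m * expR (- (lam m * s)) +
    \sum_(i <- r) pb_weight lam k i * expR (- (lam i * s)))); last first.
  by apply/funext => x; rewrite big_cons.
rewrite /continuous_at; apply: cvgD; last exact: IH.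
apply: cvgM; first exact: cvg_cst.
apply: continuous_comp; last exact: continuous_expR.
by apply: cvgN; apply: cvgM; [exact: cvg_cst|exact: cvg_id].
Qed.

(** Grid times approach the sojourn time strictly from the right. Right continuity of [N] gives
    convergence of the indicators, continuity of [pb_marginal] that of the other integrand, and
    bounded convergence applies to both. *)
Lemma prob_state_at_sojourn t k : 0 < t -> (1 <= k)%N ->
  P [set w | N (sojourn_time B t w) w = k] =
  (\int[P]_w pb_marginal lam k (sojourn_time B t w))%:E.
Proof.
move=> t0 k1; set A := [set w | _].
have PT : (P setT < +oo)%E by rewrite probability_setT ltry.
have soj0 w : 0 <= sojourn_time B t w by have /andP[] := sojourn_time_bounds B_bm t0 w.
have cvA w : \1_(state_at_grid t k n) w @[n --> \oo] --> (\1_A w : R).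
  have [e e0 He] : exists2 e, 0 < e & forall s, sojourn_time B t w < s ->
      s - sojourn_time B t w < e -> N s w = N (sojourn_time B t w) w.
    have := pb_rcont N_birth w (soj0 w); rewrite near_withinE => /nbhs_ballP[e /= e0 He].
    exists e => // s Gs se; apply: He => //.
    by rewrite /ball /= distrC ger0_norm ?subr_ge0 // ltW.
  apply: cvg_near_cst.
  have /cvgrPdist_lt /(_ e e0) := right_grid_cvg (soj0 w).
  apply: filterS => n; rewrite distrC.
  have Gn := right_grid_gt n (soj0 w).
  rewrite ger0_norm ?subr_ge0 ?ltW // => ne.
  rewrite !indicE; congr (nat_of_bool _)%:R.
  by apply/idP/idP => /set_mem h; apply/mem_set; move: h;
    rewrite /state_at_grid /A /= (He _ Gn ne).
(* The event inherits measurability from the grid events, its indicator being their pointwise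
   limit. *)
have mA : measurable A.
  have : measurable_fun setT (\1_A : T -> R).
    apply: (measurable_fun_cvg (h := fun n => \1_(state_at_grid t k n))) => [n|w _].
      by apply: measurable_indic; exact: measurable_state_at_grid.
    exact: cvA.
  move=> /(_ measurableT [set 1] (measurable_set1 1)); rewrite setTI.
  congr measurable; apply/seteqP; split=> w /=; rewrite indicE.
    by case: (boolP (w \in A)) => [/set_mem //|_ /eqP]; rewrite eq_sym oner_eq0.
  by move=> Aw; rewrite mem_set.
have c1 : \int[P]_w (\1_(state_at_grid t k n) w) @[n --> \oo] --> fine (P A).
  rewrite (_ : fine (P A) = \int[P]_w \1_A w); last first.
    by rewrite /Rintegral integral_indic // setIT.
  apply: (@bounded_Rintegral_cvg _ _ _ P setT measurableT PT _ _ 1).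
  - by move=> n; exact: measurable_indic.
  - exact: measurable_indic.
  - by apply: aeW => w _; exact: cvA.
  - by move=> n w _; rewrite ger0_norm // indic_le1.
have c2 : \int[P]_w (\1_(state_at_grid t k n) w) @[n --> \oo] -->
    \int[P]_w pb_marginal lam k (sojourn_time B t w).
  rewrite (_ : (fun n => _) = (fun n =>
    \int[P]_w pb_marginal lam k (right_grid n (sojourn_time B t w)))); last first.
    by apply/funext => n; exact: prob_state_at_grid.
  have mpb : measurable_fun setT (pb_marginal lam k).
    exact: (continuous_measurable_fun (@continuous_pb_marginal k)).
  have mG : measurable_fun setT (sojourn_time B t) := measurable_sojourn_time B_bm t.
  apply: (@bounded_Rintegral_cvg _ _ _ P setT measurableT PT _ _ 1).
  - move=> n; apply: measurableT_comp => //.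
    move=> _ C mC; rewrite setTI.
    rewrite (_ : _ @^-1` C = \bigcup_(j in [set j | C (j.+1%:R / n.+1%:R)]) cell t n j).
      by apply: bigcup_measurable => j _; exact: measurable_cell.
    apply/seteqP; split=> w /=.
      by move=> h; exists (Num.truncn (sojourn_time B t w * n.+1%:R)).
    by case=> j /= Cj cj; move: Cj; rewrite -cj.
  - exact: measurableT_comp.
  - apply: aeW => w _; apply: (cvg_comp _ _ (right_grid_cvg (soj0 w))).
    exact: continuous_pb_marginal.
  (* At nonnegative times [pb_marginal] is a probability, hence the bound 1. *)
  - move=> n w _; rewrite -(pure_birth_law N_birth) //.
      by rewrite ger0_norm ?state_prob_ge0 // state_prob_le1.
    exact/ltW/right_grid_gt0.
by rewrite -(cvg_unique _ c1 c2) // fineK // fin_num_measure.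
Qed.

End RandomTime.

Theorem theorem2p6 (R : realType) (d : measure_display) (T : measurableType d)
    (P : probability T R) (lam : nat -> R)
    (N : R -> {RV P >-> nat}) (B : R -> {RV P >-> R})
    (lam_gt0 : forall k, (1 <= k)%N -> 0 < lam k)
    (lam_distinct : forall j k, (1 <= j)%N -> (1 <= k)%N -> j <> k ->
      lam j <> lam k)
    (no_explosion : (\sum_(1 <= k <oo) ((lam k)^-1)%:E = +oo)%E)
    (N_birth : pure_birth_process lam N)
    (B_brownian : brownian_motion B)
    (NB_indep : independent_processes N B)
    (k : nat) (t : R) (k_ge1 : (1 <= k)%N) (t_gt0 : 0 < t) :
  P [set w | N (sojourn_time B t w) w = k] =
    (if (1 < k)%N then
       (\prod_(1 <= j < k) lam j) *
       \sum_(1 <= m < k.+1)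
         (expR (- (t / 2 * lam m)) * bessel_I0 (t / 2 * lam m) /
          \prod_(1 <= l < k.+1 | l != m) (lam l - lam m))
     else expR (- (t / 2 * lam 1%N)) * bessel_I0 (t / 2 * lam 1%N))%:E.
Proof.
rewrite (prob_state_at_sojourn N_birth lam_gt0 lam_distinct B_brownian NB_indep t_gt0 k_ge1).
congr EFin.
have PT : (P setT < +oo)%E by rewrite probability_setT ltry.
have int (c l : R) : 0 <= l ->
    P.-integrable setT (EFin \o (fun w => c * expR (- (l * sojourn_time B t w)))).
  move=> l0; apply: (@bounded_integrable _ _ _ P _ measurableT PT _ `|c|).
    apply: measurable_funM => //; apply: measurableT_comp => //.
    apply: measurable_funN; apply: measurable_funM => //.
    exact: measurable_sojourn_time.
  move=> w _; rewrite normrM ler_piMr // ger0_norm ?expR_ge0 //.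
  rewrite -[leRHS]expR0 ler_expR oppr_le0 mulr_ge0 //.
  by have /andP[] := sojourn_time_bounds B_brownian t_gt0 w.
have E : \int[P]_w pb_marginal lam k (sojourn_time B t w) =
    \sum_(1 <= m < k.+1) pb_weight lam k m *
      (expR (- (t / 2 * lam m)) * bessel_I0 (t / 2 * lam m)).
  (* Shifting the index makes every rate a [lam i.+1], positive by [lam_gt0], so each exponential is
     bounded and integrable. *)
  rewrite /pb_marginal big_add1 big_mkord /=.
  under eq_Rintegral do rewrite big_add1 big_mkord.
  rewrite Rintegral_sum => [|i]; last exact/int/ltW/lam_gt0.
  apply: eq_bigr => i _; rewrite -(sojourn_laplace B_brownian t_gt0) RintegralZl //.
  have := int 1 (lam i.+1) (ltW (lam_gt0 i.+1 isT)).
  by under [X in _ \o X]eq_fun do rewrite mul1r.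
rewrite E; case: ltnP => [_|k1].
  rewrite big_distrr /=; apply: eq_bigr => m _; rewrite /pb_weight.
  by rewrite -!mulrA; congr (_ * _); rewrite mulrC -!mulrA.
have -> : k = 1%N by lia.
by rewrite big_nat1 pb_weight11 mul1r.
Qed.
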